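(* Suppose that the data $(\rho^n,\mathbf u^n)$ at time $t^n$ are well-prepared, i.e. $$\rho^n=\rho^n_{(0)}+\varepsilon^2\rho^n_{(2)},\qquad \mathbf u^n=\mathbf u^n_{(0)}+\varepsilon\mathbf u^n_{(1)},\qquad \nabla\rho^n_{(0)}=0,\qquad \nabla\cdot\mathbf u^n_{(0)}=0.$$ Let $(\rho^{n+1},\mathbf u^{n+1})$, with $\mathbf q^{n+1}=\rho^{n+1}\mathbf u^{n+1}$, be defined by the reformulated first-order time semi-discrete scheme $$-\frac{\Delta t^2}{\varepsilon^2}\Delta\rho^{n+1}+\rho^{n+1}=\rho^n-\Delta t\,\nabla\cdot\hat{\mathbf q}^{n+1},\qquad \mathbf q^{n+1}=\hat{\mathbf q}^{n+1}-\Delta t\,\frac{\nabla\rho^{n+1}}{\varepsilon^2},$$ $$\hat{\mathbf q}^{n+1}:=\mathbf q^n-\Delta t\,\nabla\cdot\left(\frac{\mathbf q^n\otimes\mathbf q^n}{\rho^n}\right)-\Delta t\,\frac{\nabla(p^n-\rho^n)}{\varepsilon^2},$$ and suppose that it admits the multiscale decomposition $$\rho^{n+1}=\rho^{n+1}_{(0)}+\varepsilon^2\rho^{n+1}_{(2)},\qquad \mathbf u^{n+1}=\mathbf u^{n+1}_{(0)}+\varepsilon\mathbf u^{n+1}_{(1)}.$$ Then $(\rho^{n+1},\mathbf u^{n+1})$ is well-prepared as well, i.e. $\nabla\rho^{n+1}_{(0)}=0$ and $\nabla\cdot\mathbf u^{n+1}_{(0)}=0$. Further, the scheme reduces, as $\varepsilon\to0$,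 to a consistent discretisation of the incompressible limit system $$\partial_t\mathbf u_{(0)}+\nabla\cdot(\mathbf u_{(0)}\otimes\mathbf u_{(0)})+\nabla p_{(2)}=0,\qquad \nabla\cdot\mathbf u_{(0)}=0;$$ in other words, the scheme is weakly asymptotically consistent.
   Context: Setting: the scaled Euler equations $\partial_t\rho+\nabla\cdot\mathbf q=0$, $\partial_t\mathbf q+\nabla\cdot\left(\frac{\mathbf q\otimes\mathbf q}{\rho}\right)+\frac{\nabla p}{\varepsilon^2}=0$ on a bounded domain $\Omega$ in dimension $d\in\{1,2,3\}$, with density $\rho>0$, momentum $\mathbf q=\rho\mathbf u$, velocity $\mathbf u$, pressure $p(\rho)=\rho^\gamma$ ($\gamma\ge1$), $p^n=p(\rho^n)$, and scaled Mach number $\varepsilon$. Boundary conditions are periodic or no-flux ($\mathbf u\cdot\nu=0$ on $\partial\Omega$). $\Delta t>0$ is a fixed time step independent of $\varepsilon$. All functions are smooth enough in space for the expressions to make sense. Formal asymptotics: the coefficients with subscripts $(0),(1),(2)$ are functions of $\mathbf x$ independent of $\varepsilon$, with $\rho_{(0)}>0$. The decompositions are inserted into the scheme, nonlinear expressions such as $p(\rho)$ and $1/\rho$ are Taylor-expanded in $\varepsilon$, and the coefficients of like powers $\varepsilon^{-2},\varepsilon^{-1},\varepsilon^{0}$ on both sides are equated; the statement concerns the resulting relations between the coefficients. Weak asymptotic consistency means that, when the data at time $t^n$ are well-prepared, the scheme turns in the limit $\varepsilon\to0$ (i.e. at leading order) into a scheme for the limit system. That the scheme reduces to a consistent discretisation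 of the limit system (with the pressure $p_{(2)}$ scaled by the constant $\rho_{(0)}$) means here that the leading-order coefficients satisfy $$\frac{\mathbf u^{n+1}_{(0)}-\mathbf u^n_{(0)}}{\Delta t}+\nabla\cdot(\mathbf u^n_{(0)}\otimes\mathbf u^n_{(0)})+\nabla\pi^{n+1}=0,\qquad \nabla\cdot\mathbf u^{n+1}_{(0)}=0,$$ for some scalar function $\pi^{n+1}$, which plays the role of the incompressible pressure. *)

(* Defs.v *)
From mathcomp Require Import all_boot all_order all_algebra.
From mathcomp Require Import all_classical all_reals all_analysis.

Set Implicit Arguments.
Unset Strict Implicit.
Unset Printing Implicit Defensive.

Import Order.TTheory GRing.Theory Num.Theory.
Import numFieldNormedType.Exports.

Local Open Scope classical_set_scope.
Local Open Scope ring_scope.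

Section VectorCalculus.
Variables (R : realType) (d : nat).
Local Notation V := 'rV[R]_d.

Definition dot (v w : V) : R := \sum_(i < d) v 0 i * w 0 i.

Definition partial (i : 'I_d) (f : V -> R) (x : V) : R :=
  'D_(delta_mx 0 i) f x.

Definition grad (f : V -> R) (x : V) : V := \row_i partial i f x.

Definition div (F : V -> V) (x : V) : R :=
  \sum_(i < d) partial i (fun y => F y 0 i) x.

Definition laplacian (f : V -> R) (x : V) : R := div (grad f) x.

Definition tensor (v w : V) : 'M[R]_d := v^T *m w.

Definition divT (T : V -> 'M[R]_d) (x : V) : V :=
  \row_i \sum_(j < d) partial j (fun y => T y i j) x.

(* The class C^k up to the boundary of the open set A: all partial derivatives
   of order at most k exist in A and extend continuously to the closure of A.
   Derivatives are replaced by functions g agreeing with them on A because f is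
   total and the value of 'D outside A is not meaningful. *)
Fixpoint Ck (k : nat) (A : set V) (f : V -> R) : Prop :=
  {within closure A, continuous f} /\
  if k is k'.+1 then
    (forall x, A x -> differentiable f x) /\
    (forall i, exists2 g : V -> R, Ck k' A g &
                 forall x, A x -> partial i f x = g x)
  else True.

(* In the sense of inscribed cones: near y, A contains every cone with apex y
   and axis - nu whose opening is less than a half-space.  If A has a C^1
   boundary near y, the only such unit vector is the classical outward normal.
   A box has its usual normals on the open faces and none on the lower
   dimensional ones, so that no regularity of the boundary has to be assumed. *)
Definition outward_normal (A : set V) (y nu : V) : Prop :=
  dot nu nu = 1 /\
  forall eta : R, 0 < eta ->
    \forall z \near y, dot (z - y) nu < - (eta * `|z - y|) -> A z.

End VectorCalculus.

(* A periodic domain with period L 0 i in direction i is represented by periodic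
   functions on the whole space. *)
Variant domain (R : realType) (d : nat) : Type :=
| Periodic of 'rV[R]_d
| NoFlux of set 'rV[R]_d.

Section Domains.
Variables (R : realType) (d : nat).
Local Notation V := 'rV[R]_d.
Implicit Type D : domain R d.

Definition domain_ok D : Prop :=
  match D with
  | Periodic L => forall i, 0 < L 0 i
  | NoFlux A => [/\ open A, connected A, A !=set0 & bounded_set A]
  end.

Definition region D : set V :=
  match D with Periodic _ => setT | NoFlux A => A end.

Definition periodic (W : Type) (L : V) (f : V -> W) : Prop :=
  forall x i, f (x + L 0 i *: delta_mx 0 i) = f x.

Definition scalar_bc D (f : V -> R) : Prop :=
  match D with Periodic L => periodic L f | NoFlux _ => True end.

Definition velocity_bc D (u : V -> V) : Prop :=
  match D with
  | Periodic L => periodic L u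
  | NoFlux A => forall y nu, (closure A `\` A°) y -> outward_normal A y nu ->
                  dot (u y) nu = 0
  end.

Definition smooth D (f : V -> R) : Prop := Ck 2 (region D) f.

End Domains.

Record multiscale (R : realType) (d : nat) := Multiscale {
  rho0 : 'rV[R]_d -> R;
  rho2 : 'rV[R]_d -> R;
  u0 : 'rV[R]_d -> 'rV[R]_d;
  u1 : 'rV[R]_d -> 'rV[R]_d }.

Section Scheme.
Variables (R : realType) (d : nat).
Local Notation V := 'rV[R]_d.
Implicit Types (D : domain R d) (s : multiscale R d).

Definition density s (eps : R) (x : V) : R := rho0 s x + eps ^+ 2 * rho2 s x.

Definition velocity s (eps : R) (x : V) : V := u0 s x + eps *: u1 s x.

Definition momentum s (eps : R) (x : V) : V :=
  density s eps x *: velocity s eps x.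

Definition admissible D s : Prop :=
  [/\ smooth D (rho0 s), smooth D (rho2 s),
      forall i, smooth D (fun x => u0 s x 0 i),
      forall i, smooth D (fun x => u1 s x 0 i) &
      [/\ forall x, region D x -> 0 < rho0 s x,
          forall eps, 0 < eps -> scalar_bc D (density s eps) &
          forall eps, 0 < eps -> velocity_bc D (velocity s eps)]].

Definition well_prepared D s : Prop :=
  (forall x, region D x -> grad (rho0 s) x = 0) /\
  (forall x, region D x -> div (u0 s) x = 0).

Definition pressure (gamma r : R) : R := r `^ gamma.

Definition qhat (gamma dt eps : R) (rho : V -> R) (q : V -> V) (x : V) : V :=
  q x - dt *: divT (fun y => (rho y)^-1 *: tensor (q y) (q y)) x
      - (dt / eps ^+ 2) *: grad (fun y => pressure gamma (rho y) - rho y) x.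

Definition has_expansion (W : normedModType R) (f : R -> W) (a b c : W) : Prop :=
  (f eps - (eps ^- 2 *: a + eps^-1 *: b + c)) @[eps --> (0 : R)^'+] --> (0 : W).

Definition same_coefficients (W : normedModType R) (f g : R -> W) : Prop :=
  exists a b c, has_expansion f a b c /\ has_expansion g a b c.

(* The scheme, understood as an identity between the coefficients of eps^-2,
   eps^-1 and eps^0; s holds the data at t^n and s' those at t^{n+1}. *)
Definition scheme D (gamma dt : R) s s' : Prop :=
  let qh eps := qhat gamma dt eps (density s eps) (momentum s eps) in
  forall x, region D x ->
    same_coefficients (W := R^o)
      (fun eps => - (dt ^+ 2 / eps ^+ 2) * laplacian (density s' eps) x
                  + density s' eps x)
      (fun eps => density s eps x - dt * div (qh eps) x) /\
    same_coefficients
      (fun eps => momentum s' eps x)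
      (fun eps => qh eps x - (dt / eps ^+ 2) *: grad (density s' eps) x).

Definition incompressible_scheme D (dt : R) (u u' : V -> V) : Prop :=
  (exists pi : V -> R,
     [/\ smooth D pi, scalar_bc D pi &
         forall x, region D x ->
           dt^-1 *: (u' x - u x) + divT (fun y => tensor (u y) (u y)) x
             + grad pi x = 0]) /\
  (forall x, region D x -> div u' x = 0).

End Scheme.

(* Main.v *)
Require Import Defs.
From mathcomp Require Import all_boot all_order all_algebra.
From mathcomp Require Import all_classical all_reals all_analysis.
From mathcomp Require Import ring lra.
Import Order.TTheory GRing.Theory Num.Theory.
Import numFieldNormedType.Exports.
Local Open Scope classical_set_scope.
Local Open Scope ring_scope.

(* The order eps^-2 of the momentum update reads grad rho0' = 0.  At order 0
   the momentum update is rho0' u0' = qhat0 - dt grad rho2', and comparing its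
   divergence with the order 0 of the elliptic equation leaves
     dt rho0' div u0' = rho0 - rho0',
   so that div u0' is a constant c; it remains to show c = 0, which then also
   gives rho0' = rho0 and the limit momentum equation.

   For a periodic domain, c = 0 follows by summing finite differences of u0'
   over a lattice adapted to the periods.  A no-flux domain A has no boundary
   regularity, hence no divergence theorem.  Instead let s be the squared
   Euclidean distance to the complement of A and p(x) a nearest point to x.
   The ball centred at x and touching the boundary at p(x) makes x - p(x) an
   inner normal at p(x), so |u(x) . (x - p(x))| <= L s(x).  Testing div u = -c
   with psi = ln (1 + s / a) gives, formally,
     c \int psi = \int u . grad psi = \int 2 u . (x - p(x)) / (s + a) <= 2 L |A|,
   while \int psi is unbounded as a -> 0; hence c <= 0, and the same applies
   to -u.  As psi is semiconcave, only an upper bound of its increments is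
   needed, which suits a discrete version over a lattice of mesh h -> 0: no
   measure theory and no differentiability of psi are involved. *)

Set Implicit Arguments.
Unset Strict Implicit.
Unset Printing Implicit Defensive.

(** * Lattices and summation by parts *)

(* The two K terms cancel in the sum; see upwind_le for their purpose. *)
Lemma sum_by_parts (R : realType) (G : finZmodType) (d : nat) (e : 'I_d -> G)
    (w : 'I_d -> G -> R) (psi : G -> R) (K : R) :
  \sum_k \sum_i ((w i k + K) * (psi (k + e i) - psi k)
                 + K * (psi (k - e i) - psi k)) =
  \sum_k psi k * \sum_i (w i (k - e i) - w i k).
Proof.
rewrite exchange_big/=.
under [RHS]eq_bigr do rewrite mulr_sumr.
rewrite [RHS]exchange_big/=; apply: eq_bigr => i _.
have sh (f : G -> R) : \sum_k f (k + e i) = \sum_k f k.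
  by rewrite [RHS](reindex_inj (addIr (e i))).
have E1 : \sum_k (w i k * psi (k + e i)) = \sum_k (w i (k - e i) * psi k).
  by rewrite -[RHS]sh; apply: eq_bigr => k _; rewrite addrK.
have E2 : \sum_k psi (k - e i) = \sum_k psi k.
  by rewrite -[LHS]sh; apply: eq_bigr => k _; rewrite addrK.
transitivity (\sum_k (w i k * psi (k + e i)) - \sum_k (w i k * psi k)
   + K * (\sum_k psi (k + e i) - \sum_k psi k)
   + K * (\sum_k psi (k - e i) - \sum_k psi k)).
  rewrite !mulrBr !mulr_sumr -!sumrB -!big_split/=.
  by apply: eq_bigr => k _; ring.
rewrite E1 E2 sh !subrr !mulr0 !addr0 -sumrB.
by apply: eq_bigr => k _; ring.
Qed.

Section Lattice.
Context {R : realType} {d n : nat}.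
Local Notation V := 'rV[R]_d.
Local Notation e_ i := (delta_mx 0 i : V).
Variables (o h : V).

(** Indices are integers modulo [n + 2]: lattice shifts are then bijections of a finite group and
    summation by parts has no boundary terms, at the price of a jump where an index wraps around. *)
Definition node (k : 'rV['I_n.+2]_d) : V :=
  o + \row_i (h 0 i * (k 0 i)%:R).

Lemma node_add (k : 'rV['I_n.+2]_d) (i : 'I_d) : k 0 i != n.+1 :> nat ->
  node (k + delta_mx 0 i) = node k + h 0 i *: e_ i.
Proof.
move=> kn; apply/rowP => j; rewrite !mxE !eqxx !andTb eq_sym.
have [<-|ji] := eqVneq i j; last first.
  by rewrite addr0 mulr0 addr0.
rewrite mulr1 -addrA; congr (_ + _).
have -> : ((k 0 i + 1)%R : nat) = (k 0 i).+1.
  rewrite /= modnDmr addn1 modn_small//.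
  by have := ltn_ord (k 0 i); rewrite ltnS leq_eqVlt (negPf kn).
by rewrite -natr1 mulrDr mulr1.
Qed.

Lemma node_add_wrap (k : 'rV['I_n.+2]_d) (i : 'I_d) : k 0 i = n.+1 :> nat ->
  node (k + delta_mx 0 i) =
  node k + h 0 i *: e_ i - (h 0 i * n.+2%:R) *: e_ i.
Proof.
move=> kn; apply/rowP => j; rewrite !mxE !eqxx !andTb eq_sym.
have [<-|ji] := eqVneq i j; last first.
  by rewrite addr0 !mulr0 addr0 subr0.
have -> : ((k 0 i + 1)%R : nat) = 0%N.
  by rewrite /= kn modnDmr addn1 modnn.
by rewrite kn -[n.+2%:R]natr1 !mulr1; ring.
Qed.

(** A lattice shift acts as a translation on any [g] that does not notice the jump at the last
    index, either because [g] is periodic or because both points lie where [g] is constant. *)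
Lemma node_shift (T : Type) (g : V -> T) (i : 'I_d) :
  (forall k : 'rV['I_n.+2]_d, k 0 i = n.+1 :> nat ->
     g (node k + h 0 i *: e_ i - (h 0 i * n.+2%:R) *: e_ i) =
     g (node k + h 0 i *: e_ i)) ->
  forall k, g (node (k + delta_mx 0 i)) = g (node k + h 0 i *: e_ i).
Proof.
move=> H k; have [kn|kn] := eqVneq (k 0 i : nat) n.+1.
  by rewrite node_add_wrap// H.
by rewrite node_add.
Qed.

Lemma node_shiftN (T : Type) (g : V -> T) (i : 'I_d) :
  (forall k : 'rV['I_n.+2]_d, k 0 i = n.+1 :> nat ->
     g (node k) = g (node k - (h 0 i * n.+2%:R) *: e_ i)) ->
  forall k, g (node (k - delta_mx 0 i)) = g (node k - h 0 i *: e_ i).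
Proof.
move=> H k; set k' := k - _; have -> : k = k' + delta_mx 0 i by rewrite subrK.
have [kn|kn] := eqVneq (k' 0 i : nat) n.+1.
  by rewrite node_add_wrap// addrAC addrK H.
by rewrite node_add// addrK.
Qed.

End Lattice.

(** * Functions of class C^k along segments *)

Section LineMvt.
Context {R : realType} {d : nat}.
Local Notation V := 'rV[R]_d.
Implicit Types (A : set V) (f : V -> R) (x v : V).

Lemma derive_partial f x v : differentiable f x ->
  'D_v f x = \sum_j v 0 j * partial j f x.
Proof.
move=> df; rewrite deriveE// {1}(row_sum_delta v) linear_sum/=.
by apply: eq_bigr => j _; rewrite linearZ/= /partial deriveE.
Qed.

Lemma is_derive_line f x v (t : R) : differentiable f (x + t *: v) ->
  is_derive t 1 (fun s : R => f (x + s *: v))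
    (\sum_j v 0 j * partial j f (x + t *: v)).
Proof.
move=> df; have dv := diff_derivable (v := v) df.
have E : (fun h : R => h^-1 *: (f (x + (h *: (1 : R) + t) *: v) - f (x + t *: v))) =
         (fun h : R => h^-1 *: (f (h *: v + (x + t *: v)) - f (x + t *: v))).
  apply/funext => h; congr (_ *: (f _ - _)).
  by rewrite [h *: 1]mulr1 scalerDl addrCA.
split; first by rewrite /derivable E.
by rewrite -derive_partial// /derive E.
Qed.

Lemma segment_closure A x v : (forall t : R, 0 < t <= 1 -> A (x + t *: v)) ->
  closure A x.
Proof.
move=> H B Bx.
have : \forall t \near (0 : R)^'+, B (x + t *: v).
  have : (x + t *: v) @[t --> (0:R)^'+] --> x.
    rewrite -[X in _ --> X]addr0 -(scale0r v); apply: cvgD; first exact: cvg_cst.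
    by apply: cvgZr_tmp; apply: cvg_at_right_filter; exact: cvg_id.
  exact.
move=> HB; near (0 : R)^'+ => t.
exists (x + t *: v); split; last by near: t.
by apply: H; apply/andP; split => //; near: t; exact: nbhs_right_le.
Unshelve. all: end_near. Qed.

(** Only the points with [t > 0] have to lie in [A]: the segment may start on the boundary, where
    continuity on the closure suffices. *)
Lemma line_mvt A f x v : {within closure A, continuous f} ->
  (forall z, A z -> differentiable f z) ->
  (forall t : R, 0 < t <= 1 -> A (x + t *: v)) ->
  exists2 t : R, 0 < t < 1 &
    f (x + v) - f x = \sum_j v 0 j * partial j f (x + t *: v).
Proof.
move=> cf df Axv.
have [||] := @MVT R (fun s : R => f (x + s *: v))
  (fun t => \sum_j v 0 j * partial j f (x + t *: v)) 0 1 ltr01.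
- move=> t; rewrite in_itv/= => /andP[t0 t1].
  by apply: is_derive_line; apply: df; apply: Axv; rewrite t0 ltW.
- have ccl (t : R) : `[0, 1]%classic t -> closure A (x + t *: v).
    rewrite /= in_itv/= => /andP[]; rewrite le_eqVlt => /predU1P[<- _|t0 t1].
      by rewrite scale0r addr0; exact: segment_closure Axv.
    by apply: subset_closure; apply: Axv; rewrite t0.
  apply/subspace_continuousP => t t01.
  have /subspace_continuousP/(_ _ (ccl t t01)) := cf.
  apply: cvg_comp => P HP.
  have H1 : (x + s *: v) @[s --> t] --> (x + t *: v).
    by apply: cvgD; [exact: cvg_cst|apply: cvgZr_tmp; exact: cvg_id].
  have {}H1 : \forall s \near t, closure A (x + s *: v) -> P (x + s *: v).
    exact: (H1 _ HP).
  by apply: filterS H1 => s /= Hs /ccl; exact: Hs.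
- move=> t; rewrite in_itv/= => t01; rewrite scale1r scale0r addr0 subr0 mulr1.
  by exists t.
Qed.
End LineMvt.

Section Bounds.
Context {R : realType} {d : nat}.
Local Notation V := 'rV[R]_d.
Local Notation e_ i := (delta_mx 0 i : V).
Implicit Types (A K : set V) (f : V -> R) (x v : V).

(** The sum of the absolute values of the individual bounds dominates each of them. This merges
    bounds found coordinate by coordinate into one. *)
Lemma uniform_bound (I : finType) (P : I -> R -> Prop) :
  (forall i a b, a <= b -> P i a -> P i b) -> (forall i, exists a, P i a) ->
  exists2 a, 0 <= a & forall i, P i a.
Proof.
move=> Pmono /choice[b Pb]; exists (\sum_i `|b i|); first exact: sumr_ge0.
move=> i; apply: Pmono (Pb i); apply: le_trans (ler_norm _) _.
by rewrite (bigD1 i)//= lerDl sumr_ge0.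
Qed.

Lemma within_bounded K f : compact K -> {within K, continuous f} ->
  exists2 B, 0 <= B & forall x, K x -> `|f x| <= B.
Proof.
move=> cK cf; have /compact_bounded[M [Mr HM]] := continuous_compact cf cK.
exists (`|M| + 1); first by rewrite addr_ge0.
move=> x Kx; apply: (HM (`|M| + 1)); last by exists x.
by rewrite (le_lt_trans (ler_norm _))// ltrDl.
Qed.

Lemma Ck_within k A f : Ck k A f -> {within closure A, continuous f}.
Proof. by case: k => [|k] []. Qed.

Lemma Ck_differentiable k A f : Ck k.+1 A f ->
  forall x, A x -> differentiable f x.
Proof. by move=> [_ []]. Qed.

Lemma Ck_partial k A f i : Ck k.+1 A f ->
  exists2 g, Ck k A g & forall x, A x -> partial i f x = g x.
Proof. by move=> [_ [_ /(_ i)]]. Qed.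

Lemma Ck_partial_bounded k A K f : compact K -> K `<=` closure A ->
  Ck k.+1 A f ->
  exists2 B, 0 <= B & forall i x, K x -> A x -> `|partial i f x| <= B.
Proof.
move=> cK KA Cf.
apply: uniform_bound => [i a b ab Pa x Kx Ax|i].
  exact: le_trans (Pa _ Kx Ax) _.
have [g /Ck_within cg gf] := Ck_partial i Cf.
have [B _ HB] := within_bounded cK (continuous_subspaceW KA cg).
by exists B => x Kx Ax; rewrite gf// HB.
Qed.

Lemma Ck_lipschitz_segment k A f : compact (closure A) -> Ck k.+1 A f ->
  exists2 B, 0 <= B & forall x v, (forall t : R, 0 < t <= 1 -> A (x + t *: v)) ->
    `|f (x + v) - f x| <= B * \sum_j `|v 0 j|.
Proof.
move=> cA Cf.
have [B B0 HB] := Ck_partial_bounded cA (@subset_refl _ _) Cf.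
exists B => // x v Axv.
have [t /andP[t0 t1] ->] := line_mvt (Ck_within Cf) (Ck_differentiable Cf) Axv.
rewrite mulr_sumr; apply: le_trans (ler_norm_sum _ _ _) _.
apply: ler_sum => j _; rewrite normrM mulrC ler_wpM2r//.
have At : A (x + t *: v) by apply: Axv; rewrite t0 ltW.
by apply: HB => //; exact: subset_closure.
Qed.

Lemma line_reverse (x v : V) (h t : R) :
  x - h *: v + t *: (h *: v) = x - ((1 - t) * h) *: v.
Proof. by rewrite scalerA mulrBl mul1r scalerBl opprB addrAC -addrA. Qed.

Lemma sum_delta (i : 'I_d) (a : R) (F : 'I_d -> R) :
  \sum_j (a *: e_ i) 0 j * F j = a * F i.
Proof.
rewrite (bigD1 i)//= big1 ?addr0 => [|j ji]; rewrite !mxE !eqxx/=.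
  by rewrite mulr1.
by rewrite (negPf ji) mulr0 mul0r.
Qed.

(** Two uses of the mean value theorem: the first turns the increment of [f] into a partial
    derivative at an intermediate point, the second compares that derivative with its value at [x].
    The compact set [K] provides the bound on second derivatives, as the closure of a periodic
    domain is the whole space. *)
Lemma Ck_difference_quotient k A K f : compact K -> K `<=` closure A ->
  Ck k.+2 A f ->
  exists2 B, 0 <= B & forall i x (h : R), 0 <= h ->
    (forall t : R, 0 <= t <= h -> A (x - t *: e_ i) /\ K (x - t *: e_ i)) ->
    `|f (x - h *: e_ i) - f x + h * partial i f x| <= B * h ^+ 2.
Proof.
move=> cK KA Cf; have cf := Ck_within Cf; have df := Ck_differentiable Cf.
apply: uniform_bound => [i a b ab Pa x h h0 Ax|i].
  by apply: le_trans (Pa _ _ h0 Ax) _; rewrite ler_wpM2r// sqr_ge0.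
have [g Cg gf] := Ck_partial i Cf.
have [B B0 HB] := Ck_partial_bounded cK KA Cg.
exists B => x h h0 Ax.
have Axh (t : R) : 0 < t <= 1 -> A (x - h *: e_ i + t *: (h *: e_ i)).
  move=> /andP[t0 t1]; rewrite line_reverse; apply: (Ax _ _).1.
  rewrite mulr_ge0 ?subr_ge0//= ler_piMl// gerBl; exact: ltW.
have [t /andP[t0 t1]] := line_mvt cf df Axh.
rewrite subrK sum_delta line_reverse => E.
rewrite -opprB E.
set s := (1 - t) * h.
have s0 : 0 <= s by rewrite mulr_ge0// subr_ge0 ltW.
have sh : s <= h by rewrite ler_piMl// gerBl ltW.
clearbody s.
have Axs (r : R) : 0 < r <= 1 -> A (x - s *: e_ i + r *: (s *: e_ i)).
  move=> /andP[r0 r1].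
  rewrite line_reverse.
  apply: (Ax _ _).1; rewrite mulr_ge0 ?subr_ge0//= (le_trans _ sh)//.
  by rewrite ler_piMl// gerBl ltW.
have [As Ks] := Ax s (introT andP (conj s0 sh)).
have [A0 K0] := Ax 0 (introT andP (conj (lexx _) h0)).
rewrite scale0r subr0 in A0 K0.
have [r /andP[r0 r1]] := line_mvt (Ck_within Cg) (Ck_differentiable Cg) Axs.
rewrite subrK sum_delta -!gf// => E2.
rewrite addrC -mulrBr E2.
rewrite line_reverse; set q := (1 - r) * s.
have qh : 0 <= q <= h.
  rewrite mulr_ge0 ?subr_ge0 ?(ltW r1)//= (le_trans _ sh)//.
  by rewrite ler_piMl// gerBl ltW.
have [Aq Kq] := Ax q qh.
rewrite !normrM (ger0_norm h0) (ger0_norm s0).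
have bB := HB i _ Kq Aq.
rewrite (_ : B * h ^+ 2 = h * (h * B)); last by ring.
by rewrite ler_wpM2l// ler_pM.
Qed.
End Bounds.

(** * Nearest points *)

Lemma cvg_finsum (R : realType) (T : Type) (F : set_system T) (FF : Filter F)
    (I : Type) (r : seq I) (f : I -> T -> R) (l : I -> R) :
  (forall i, f i x @[x --> F] --> l i) ->
  \sum_(i <- r) f i x @[x --> F] --> \sum_(i <- r) l i.
Proof.
move=> fl; elim: r => [|i r IH].
  by under eq_fun do rewrite big_nil; rewrite big_nil; exact: cvg_cst.
under eq_fun do rewrite big_cons; rewrite big_cons.
by apply: cvgD.
Qed.

Section NearestPoint.
Context {R : realType} {d : nat}.
Local Notation V := 'rV[R]_d.
Local Notation e_ i := (delta_mx 0 i : V).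
Implicit Types (A F : set V) (x y z v w : V).

Definition sqdist x y : R := dot (x - y) (x - y).

Lemma coord_le_norm v j : `|v 0 j| <= `|v|.
Proof.
rewrite {2}/Num.Def.normr/= mx_normrE; apply/bigmax_geP; right => /=.
by exists (0, j).
Qed.

Lemma norm_le_coord v (r : R) : 0 <= r -> (forall j, `|v 0 j| <= r) -> `|v| <= r.
Proof.
move=> r0 H; rewrite {1}/Num.Def.normr/= mx_normrE; apply/bigmax_leP; split => //.
by case=> i j _ /=; rewrite ord1.
Qed.

Lemma dot_ge0 v : 0 <= dot v v.
Proof. by apply: sumr_ge0 => i _; rewrite -expr2 sqr_ge0. Qed.

Lemma normsq_le_dot v : `|v| ^+ 2 <= dot v v.
Proof.
rewrite -[leRHS]sqr_sqrtr ?dot_ge0//.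
rewrite ler_pXn2r ?nnegrE ?sqrtr_ge0//.
apply: norm_le_coord => [|j]; first exact: sqrtr_ge0.
rewrite -sqrtr_sqr ler_sqrt ?dot_ge0//.
rewrite /dot (bigD1 j)//= expr2 lerDl.
by apply: sumr_ge0 => i _; rewrite -expr2 sqr_ge0.
Qed.

Lemma dot_le_normsq v : dot v v <= d%:R * `|v| ^+ 2.
Proof.
have -> : d%:R * `|v| ^+ 2 = \sum_(i < d) `|v| ^+ 2.
  by rewrite sumr_const card_ord mulr_natl.
apply: ler_sum => i _; rewrite -expr2 -(real_normK (num_real (v 0 i))).
by rewrite ler_pXn2r ?nnegrE// coord_le_norm.
Qed.

Lemma dotC v w : dot v w = dot w v.
Proof. by apply: eq_bigr => i _; rewrite mulrC. Qed.

Lemma dotDl v w z : dot (v + w) z = dot v z + dot w z.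
Proof. by rewrite -big_split/=; apply: eq_bigr => i _; rewrite mxE mulrDl. Qed.

Lemma dotZl a v w : dot (a *: v) w = a * dot v w.
Proof. by rewrite mulr_sumr; apply: eq_bigr => i _; rewrite mxE mulrA. Qed.

Lemma dotDr v w z : dot z (v + w) = dot z v + dot z w.
Proof. by rewrite dotC dotDl !(dotC z). Qed.

Lemma dotZr a v w : dot w (a *: v) = a * dot w v.
Proof. by rewrite dotC dotZl (dotC w). Qed.

Lemma dotNl v w : dot (- v) w = - dot v w.
Proof. by rewrite -scaleN1r dotZl mulN1r. Qed.

Lemma dotNr v w : dot w (- v) = - dot w v.
Proof. by rewrite dotC dotNl (dotC w). Qed.

Lemma dot_eq0 v : dot v v = 0 -> v = 0.
Proof.
move=> v0; have := normsq_le_dot v; rewrite v0 => H; apply/eqP.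
rewrite -normr_eq0 -sqrf_eq0; apply/eqP/le_anti.
by rewrite H sqr_ge0.
Qed.

Lemma dot_deltal i v : dot (e_ i) v = v 0 i.
Proof.
rewrite /dot (bigD1 i)//= big1 ?addr0 => [|j ji]; rewrite !mxE eqxx/=.
  by rewrite eqxx mul1r.
by rewrite (negPf ji) mul0r.
Qed.

Lemma continuous_sqdist x : continuous (sqdist x).
Proof.
suff H (y : V) : sqdist x z @[z --> y] --> sqdist x y by [].
rewrite /sqdist /dot.
apply: (@cvg_finsum R V (nbhs y) _ 'I_d _
  (fun i y => (x - y) 0 i * (x - y) 0 i)) => i.
have H0 : x - z @[z --> y] --> x - y.
  exact: (@cvgB _ _ _ (nbhs y) _ (fun=> x) id x y (cvg_cst x) cvg_id).
have {}H : (x - z) 0 i @[z --> y] --> (x - y) 0 i.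
  have H1 := @coord_continuous R 1 d 0 i (x - y).
  apply: (@cvg_comp _ _ _ (fun z => x - z) (fun z : V => z 0 i) _ _ _ H0); exact: H1.
exact: cvgM.
Qed.

Lemma nearest_point F : closed F -> F !=set0 ->
  exists p : V -> V, forall x, F (p x) /\
    forall z, F z -> sqdist x (p x) <= sqdist x z.
Proof.
move=> cF [z0 Fz0]; suff : forall x, exists y,
    F y /\ forall z, F z -> sqdist x y <= sqdist x z.
  by move=> /choice[p Hp]; exists p.
move=> x; pose r := sqdist x z0 + 1.
have r1 : 1 <= r by rewrite lerDr dot_ge0.
pose K := F `&` [set z | `|x - z| <= r].
have far z : sqdist x z <= sqdist x z0 -> `|x - z| <= r.
  move=> H; rewrite -(@ler_pXn2r _ 2) ?nnegrE ?(le_trans ler01 r1)//.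
  apply: le_trans (normsq_le_dot _) _; apply: le_trans H _.
  apply: (@le_trans _ _ r); first by rewrite lerDl.
  by rewrite expr2 ler_peMl// (le_trans ler01 r1).
have Kz0 : K z0 by split => //; exact: far.
have cK : compact K.
  apply: bounded_closed_compact.
    exists (`|x| + r); split; first exact: num_real.
    move=> M HM z [_ /= xz]; apply: le_trans (ltW HM).
    have -> : z = x - (x - z) by rewrite opprB addrC subrK.
    by apply: le_trans (ler_normB _ _) _; rewrite lerD2l.
  by apply: closedI => //; exact: closed_closed_ball_.
have [||y] := @compact_EVT_min _ _ (sqdist x) K _ cK.
- by exists z0.
- exact/continuous_subspaceT/continuous_sqdist.
rewrite inE => -[Fy _] Hy; exists y; split => // z Fz.
have [zz0|] := leP (sqdist x z) (sqdist x z0).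
  by apply: Hy; rewrite inE; split => //; exact: far.
by move=> /ltW; apply: le_trans; apply: Hy; rewrite inE.
Qed.

Lemma sqdistDl x y v : sqdist (x + v) y = sqdist x y + 2 * dot v (x - y) + dot v v.
Proof.
rewrite /sqdist addrAC; move: (x - y) => w.
by rewrite !dotDl !dotDr (dotC w v); ring.
Qed.

(** The open Euclidean ball about [x] through [y] contains no point of the complement. For [z] in
    the cone, [sqdist x z] is [sqdist x y] plus a negative linear term in [z - y] plus a quadratic
    one; close to [y] the linear term wins and [z] is in the ball. *)
Lemma nearest_outward_normal A x y : A x -> ~ A y ->
  (forall z, ~ A z -> sqdist x y <= sqdist x z) ->
  outward_normal A y ((Num.sqrt (sqdist x y))^-1 *: (y - x)).
Proof.
move=> Ax nAy Hy; set s := sqdist x y.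
have s0 : 0 < s.
  rewrite lt_neqAle dot_ge0 andbT eq_sym; apply/eqP => /dot_eq0/eqP.
  by rewrite subr_eq0 => /eqP xy; apply: nAy; rewrite -xy.
set r := Num.sqrt s; have r0 : 0 < r by rewrite sqrtr_gt0.
have r2 : r * r = s by rewrite -expr2 sqr_sqrtr// ltW.
split.
  rewrite dotZl dotZr -opprB dotNl dotNr opprK -/(sqdist x y) -/s -r2 mulrA.
  by rewrite mulrACA mulVf ?gt_eqF// mulr1.
move=> eta eta0; near=> z; rewrite dotZr => Hz.
apply: contrapT => /Hy; apply/negP; rewrite -ltNge.
have -> : sqdist x z = sqdist z y + 2 * dot (z - y) (y - x) + s.
  rewrite /s /sqdist.
  have -> : x - z = - ((z - y) + (y - x)) by rewrite addrA subrK opprB.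
  rewrite -(opprB y x) !dotNl !dotNr !opprK.
  move: (z - y) (y - x) => w1 w2.
  by rewrite !dotDl !dotDr (dotC w2 w1); ring.
rewrite -/s gtrDr.
set q := dot (z - y) (y - x) in Hz *.
have Hq : q < - (r * (eta * `|z - y|)).
  by rewrite -mulrN -ltr_pdivrMl.
have zn : d%:R * `|z - y| <= r * eta.
  (* Dividing by [d + 1] rather than [d] keeps the radius positive when [d = 0]. *)
  have zy : `|z - y| <= r * eta / d.+1%:R.
    rewrite distrC; apply: ltW; near: z.
    have /(nbhsx_ballx y) : 0 < r * eta / d.+1%:R by rewrite divr_gt0 ?mulr_gt0.
    by rewrite -ball_normE.
  rewrite ler_pdivlMr// in zy; apply: le_trans zy.
  by rewrite mulrC ler_wpM2l// ler_nat.
have := dot_le_normsq (z - y); rewrite -/(sqdist z y) => dz.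
have : d%:R * `|z - y| ^+ 2 <= r * (eta * `|z - y|).
  by rewrite expr2 !mulrA ler_wpM2r.
have : 0 <= r * (eta * `|z - y|) by rewrite !mulr_ge0// ltW.
lra.
Unshelve. all: end_near. Qed.

End NearestPoint.

(** * Vector fields with constant divergence *)

Section DistancePotential.
Context {R : realType} {d : nat}.
Local Notation V := 'rV[R]_d.
Local Notation e_ i := (delta_mx 0 i : V).
Variables (A : set V) (p : V -> V).
Hypothesis pA : forall x, ~ A (p x).
Hypothesis pmin : forall x z, ~ A z -> sqdist x (p x) <= sqdist x z.

Let s x : R := sqdist x (p x).

Definition potential (a : R) x : R := ln (1 + s x / a).

Lemma sqdist_out x : ~ A x -> s x = 0.
Proof.
move=> nAx; apply/le_anti; rewrite dot_ge0 andbT.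
apply: le_trans (pmin x nAx) _; rewrite /sqdist subrr -(scale0r 0) dotZl.
by rewrite mul0r.
Qed.

Lemma sqdist_lt_in x z : sqdist x z < s x -> A z.
Proof. by move=> H; apply: contrapT => /(pmin x); rewrite leNgt H. Qed.

(** These points are strictly closer to [x] than its nearest point in the complement. *)
Lemma nearest_segment x : A x ->
  forall t : R, 0 < t <= 1 -> A (p x + t *: (x - p x)).
Proof.
move=> Ax t /andP[t0 t1]; apply: (@sqdist_lt_in x).
have -> : sqdist x (p x + t *: (x - p x)) = (1 - t) ^+ 2 * s x.
  rewrite /s /sqdist opprD addrA -[X in X - _](scale1r (x - p x)) -scalerBl.
  by rewrite dotZl dotZr mulrA expr2.
have s0 : 0 < s x.
  rewrite lt_neqAle dot_ge0 andbT eq_sym; apply/eqP => /dot_eq0/eqP.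
  by rewrite subr_eq0 => /eqP E; apply: (@pA x); rewrite -E.
by rewrite gtr_pMl// expr_lt1 ?subr_ge0// gtrBl.
Qed.

Variables (a : R) (a0 : 0 < a).

Let sa_ge0 x : 0 <= s x / a.
Proof. by rewrite divr_ge0 ?dot_ge0// ltW. Qed.

Lemma potential_ge0 x : 0 <= potential a x.
Proof. by rewrite ln_ge0// lerDl sa_ge0. Qed.

Lemma potential_le x : potential a x <= s x / a.
Proof. by apply: le_ln1Dx; rewrite (lt_le_trans _ (sa_ge0 x)). Qed.

Lemma potential_out x : ~ A x -> potential a x = 0.
Proof. by move=> nAx; rewrite /potential sqdist_out// mul0r addr0 ln1. Qed.

(* The squared distance is an infimum of the functions [|. - y|^2], hence
   semiconcave; so is its image under an increasing concave function. *)
Lemma potentialD_le x v :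
  potential a (x + v) - potential a x <=
  (2 * dot v (x - p x) + dot v v) / (s x + a).
Proof.
have sx0 : 0 < s x + a by rewrite ltr_wpDl// dot_ge0.
have H : s (x + v) <= s x + (2 * dot v (x - p x) + dot v v).
  apply: le_trans (pmin _ (@pA x)) _.
  by rewrite sqdistDl addrA.
set q := 2 * _ + _ in H *.
have q1 : 0 < 1 + q / (s x + a).
  rewrite -(@pmulr_rgt0 _ (s x + a))// mulrDr mulr1 mulrC divfK ?gt_eqF//.
  by rewrite addrAC ltr_wpDl// (le_trans _ H)// dot_ge0.
have pos z : 0 < 1 + s z / a by rewrite ltr_pwDl.
(* Since [ln (1 + t) <= t], it suffices to bound the ratio of the arguments of the two logarithms by
   [1 + q / (s x + a)]. *)
apply: le_trans (le_ln1Dx _); last by rewrite -subr_gt0 opprK addrC.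
rewrite lerBlDr /potential -lnM ?posrE//.
rewrite ler_ln ?posrE ?mulr_gt0//.
have -> : (1 + q / (s x + a)) * (1 + s x / a) = 1 + (s x + q) / a.
  by field; rewrite !gt_eqF.
by rewrite lerD2l ler_wpM2r// invr_ge0 ltW.
Qed.

End DistancePotential.

(** Cauchy-Schwarz against the constant vector 1, read off from the nonnegative double sum of the
    squares of [a i - a j]. *)
Lemma sqr_suml_le (R : realDomainType) (d : nat) (a : 'I_d -> R) :
  (\sum_i a i) ^+ 2 <= d%:R * \sum_i a i ^+ 2.
Proof.
have H : 0 <= \sum_i \sum_j (a i - a j) ^+ 2.
  by apply: sumr_ge0 => i _; apply: sumr_ge0 => j _; rewrite sqr_ge0.
have E : \sum_i \sum_j (a i - a j) ^+ 2 =
         2 * (d%:R * \sum_i a i ^+ 2) - 2 * (\sum_i a i) ^+ 2.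
  have E1 i : \sum_j (a i - a j) ^+ 2 =
      d%:R * a i ^+ 2 + \sum_j a j ^+ 2 - 2 * (a i * \sum_j a j).
    rewrite !mulr_sumr mulr_natl -[X in _ *+ X]card_ord -sumr_const.
    by rewrite -big_split/= -sumrB; apply: eq_bigr => j _; ring.
  rewrite (eq_bigr _ (fun i _ => E1 i)) sumrB big_split/= -!mulr_sumr -mulr_suml.
  rewrite sumr_const card_ord -[X in _ + X - _]mulr_natl; ring.
by rewrite E subr_ge0 ler_pM2l in H.
Qed.

(** * The discrete divergence argument in a no-flux domain *)

Section NoFluxDivergence.
Context {R : realType} {d : nat}.
Local Notation V := 'rV[R]_d.
Local Notation e_ i := (delta_mx 0 i : V).
Variables (A : set V) (p u : V -> V).
Hypotheses (oA : open A) (bA : bounded_set A).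
Hypothesis pA : forall x, ~ A (p x).
Hypothesis pmin : forall x z, ~ A z -> sqdist x (p x) <= sqdist x z.
Hypothesis Cu : forall i, Ck 2 A (fun x => u x 0 i).
Hypothesis bcu : forall y nu, (closure A `\` A°) y -> outward_normal A y nu ->
  dot (u y) nu = 0.

Let s x : R := sqdist x (p x).
(** Extension by zero lets the lattice sums run over a whole box containing [A]. *)
Let ut i (x : V) : R := if x \in A then u x 0 i else 0.

Lemma compact_closure : compact (closure A).
Proof.
apply: bounded_closed_compact; last exact: closed_closure.
have [M [Mr HM]] := bA; exists M; split => // N MN x clx.
apply/ler_addgt0Pr => e e0.
have /(nbhsx_ballx x)/clx : 0 < e by [].
move=> [y [/(HM _ MN) yN]]; rewrite -ball_normE/= => xy.
rewrite -(subrK y x) (le_trans (ler_normD _ _))// addrC lerD//.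
exact: ltW.
Qed.

(** The no-flux condition makes [u (p x)] orthogonal to [x - p x], so only [u x - u (p x)] counts.
    This difference is Lipschitz along the segment from [p x] to [x], and Cauchy-Schwarz bounds the
    squared sum of the coordinates by [d * s x]. *)
Lemma flux_bound : exists2 L, 0 <= L &
  forall x, `|\sum_i ut i x * (x - p x) 0 i| <= L * s x.
Proof.
have : exists2 B, 0 <= B & forall i x v,
    (forall t : R, 0 < t <= 1 -> A (x + t *: v)) ->
    `|u (x + v) 0 i - u x 0 i| <= B * \sum_j `|v 0 j|.
  apply: uniform_bound => [i a b ab Ha x v /Ha H|i].
    by apply: le_trans H _; rewrite ler_wpM2r// sumr_ge0.
  by have [B _ HB] := Ck_lipschitz_segment compact_closure (Cu i); exists B.
move=> [B B0 HB]; exists (B * d%:R) => [|x]; first by rewrite mulr_ge0.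
have [Ax|nAx] := pselect (A x); last first.
  rewrite big1 ?normr0 => [|i _]; first by rewrite !mulr_ge0// dot_ge0.
  by rewrite /ut ifF ?mul0r//; apply/negP; rewrite inE.
have seg := nearest_segment pA pmin Ax.
have onorm := nearest_outward_normal Ax (@pA x) (pmin x).
have u0 : \sum_i u (p x) 0 i * (x - p x) 0 i = 0.
  have : dot (u (p x)) ((Num.sqrt (s x))^-1 *: (p x - x)) = 0.
    apply: bcu => //; split; first exact: segment_closure seg.
    by move=> /interior_subset; exact: pA.
  rewrite dotZr -opprB dotNr => /eqP; rewrite mulf_eq0 oppr_eq0 => /orP[|/eqP//].
  rewrite invr_eq0 sqrtr_eq0 => H.
  have /dot_eq0/eqP : s x = 0 by apply/le_anti; rewrite H dot_ge0.
  by move=> /eqP ->; rewrite big1// => i _; rewrite mxE mulr0.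
set v := x - p x in seg u0 *.
have -> : \sum_i ut i x * v 0 i = \sum_i (u (p x + v) 0 i - u (p x) 0 i) * v 0 i.
  rewrite -[LHS]subr0 -[X in _ - X]u0 -sumrB; apply: eq_bigr => i _.
  by rewrite /ut mem_set// (_ : p x + v = x) ?[p x + v]addrC ?subrK//; ring.
apply: le_trans (ler_norm_sum _ _ _) _.
apply: (@le_trans _ _ (\sum_i (B * \sum_j `|v 0 j|) * `|v 0 i|)).
  by apply: ler_sum => i _; rewrite normrM ler_wpM2r// HB.
rewrite -mulr_sumr -mulrA -expr2 -mulrA ler_wpM2l//.
apply: le_trans (sqr_suml_le _) _; rewrite ler_wpM2l//.
by apply: ler_sum => i _; rewrite real_normK ?num_real// expr2.
Qed.

Lemma flow_bound : exists2 K, 0 <= K & forall i x, `|ut i x| <= K.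
Proof.
apply: uniform_bound => [i a b ab Ha x|i]; first exact: le_trans (Ha x) ab.
have [B B0 HB] := within_bounded compact_closure (Ck_within (Cu i)).
exists B => x; rewrite /ut; case: ifPn => [|_]; last by rewrite normr0.
by rewrite inE => Ax; apply: HB; exact: subset_closure.
Qed.

Section Estimates.
Variables (K L a h : R).
Hypotheses (K0 : 0 <= K) (L0 : 0 <= L) (HK : forall i x, `|ut i x| <= K).
Hypothesis HL : forall x, `|\sum_i ut i x * (x - p x) 0 i| <= L * s x.
Hypotheses (a0 : 0 < a) (h0 : 0 < h).
Let psi := potential p a.

(* Adding K to the velocity makes the coefficients of the forward and of the
   backward increments of psi nonnegative, so that the one-sided bound
   potentialD_le applies to both. *)
Lemma upwind_le x :
  \sum_i ((ut i x + K) * (psi (x + h *: e_ i) - psi x)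
          + K * (psi (x - h *: e_ i) - psi x)) <=
  2 * h * L + 3 * K * d%:R * h ^+ 2 / a.
Proof.
have sx0 : 0 <= s x by exact: dot_ge0.
have sa0 : 0 < s x + a by rewrite ltr_wpDl.
set w := x - p x.
have HP i : psi (x + h *: e_ i) - psi x <= (2 * (h * w 0 i) + h ^+ 2) / (s x + a).
  apply: le_trans (potentialD_le pA pmin a0 _ _) _.
  rewrite dotZl dot_deltal dotZl dotZr dot_deltal.
  by rewrite [delta_mx _ _ _ _]mxE !eqxx mulr1 -expr2.
have HN i : psi (x - h *: e_ i) - psi x <=
    (- (2 * (h * w 0 i)) + h ^+ 2) / (s x + a).
  apply: le_trans (potentialD_le pA pmin a0 _ _) _.
  rewrite dotNl dotZl dot_deltal dotNl dotNr opprK dotZl dotZr dot_deltal.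
  by rewrite [delta_mx _ _ _ _]mxE !eqxx mulr1 -expr2 mulrN.
(* The terms of order [h] with factor [K] cancel; those of order [h ^+ 2] have total weight
   [ut i x + 2 * K], at most [3 * K]. *)
have Hi i : (ut i x + K) * (psi (x + h *: e_ i) - psi x)
          + K * (psi (x - h *: e_ i) - psi x) <=
   (s x + a)^-1 * (2 * h * (ut i x * w 0 i) + 3 * K * h ^+ 2).
  have utK : 0 <= ut i x + K.
    by rewrite -lerBlDr sub0r; have := HK i x; rewrite ler_norml => /andP[].
  have utK' : ut i x <= K by have := HK i x; rewrite ler_norml => /andP[].
  apply: le_trans (lerD (ler_wpM2l utK (HP i)) (ler_wpM2l K0 (HN i))) _.
  rewrite (mulrC (s x + a)^-1) !mulrA -mulrDl ler_wpM2r ?invr_ge0 ?(ltW sa0)//.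
  have h2 : 0 <= h ^+ 2 by rewrite sqr_ge0.
  have : ut i x * h ^+ 2 <= K * h ^+ 2 by rewrite ler_wpM2r.
  lra.
apply: le_trans (ler_sum _ (fun i _ => Hi i)) _.
rewrite -mulr_sumr big_split/= -mulr_sumr sumr_const card_ord -[_ *+ d]mulr_natr.
have HLx : \sum_i ut i x * w 0 i <= L * s x.
  by have := HL x; rewrite ler_norml => /andP[].
have C0 : 0 <= 3 * K * d%:R * h ^+ 2.
  by rewrite mulr_ge0 ?sqr_ge0// !mulr_ge0.
apply: (@le_trans _ _ ((s x + a)^-1 * (2 * h * (L * s x)
                       + 3 * K * d%:R * h ^+ 2))).
  rewrite ler_wpM2l ?invr_ge0 ?(ltW sa0)//.
  by rewrite (mulrAC (3 * K)) lerD2r ler_wpM2l// mulr_ge0// ltW.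
(* The flux term uses [s x / (s x + a) <= 1], the error term [(s x + a)^-1 <= a^-1]. *)
rewrite mulrDr lerD//.
  have -> : (s x + a)^-1 * (2 * h * (L * s x)) = (2 * h * L) * (s x / (s x + a)).
    by ring.
  rewrite ler_piMr ?mulr_ge0 ?(ltW h0)// ler_pdivrMr// mul1r lerDl; exact: ltW.
by rewrite mulrC ler_wpM2l// lef_pV2 ?posrE// lerDr.
Qed.

Lemma dot_delta i (t : R) : dot (t *: e_ i) (t *: e_ i) = t ^+ 2.
Proof.
by rewrite dotZl dotZr dot_deltal [delta_mx _ _ _ _]mxE !eqxx mulr1 expr2.
Qed.

(** Where [s x <= h ^+ 2], [psi x] is at most [h ^+ 2 / a], and the crude bound [2 * K] on each
    difference goes into the error term. Elsewhere the backward segments of length [h] stay in [A],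
    so the differences add up to [- h * div u x = h * c] up to [d * B * h ^+ 2], which costs at most
    half of it. *)
Lemma downwind_ge (B c : R) x : 0 <= B -> 0 < c ->
  (forall i z, (forall t : R, 0 <= t <= h -> A (z - t *: e_ i)) ->
     `|u (z - h *: e_ i) 0 i - u z 0 i
       + h * partial i (fun y => u y 0 i) z| <= B * h ^+ 2) ->
  (forall z, A z -> div u z = - c) ->
  d%:R * (B * h) <= c / 2 ->
  h * c / 2 * psi x - (2 * K * d%:R + h * c / 2) * (h ^+ 2 / a) <=
  psi x * \sum_i (ut i (x - h *: e_ i) - ut i x).
Proof.
move=> B0 c0 HB Hdiv Bh.
have psi0 : 0 <= psi x by exact: potential_ge0.
have hc0 : 0 <= h * c / 2 by rewrite divr_ge0// mulr_ge0// ltW.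
have C0 : 0 <= 2 * K * d%:R by rewrite !mulr_ge0.
have h2a : 0 <= h ^+ 2 / a by rewrite divr_ge0 ?sqr_ge0// ltW.
have [sh|sh] := leP (s x) (h ^+ 2).
  have Hsum : - (2 * K * d%:R) <= \sum_i (ut i (x - h *: e_ i) - ut i x).
    have -> : - (2 * K * d%:R) = \sum_(i < d) (- (2 * K)).
      by rewrite sumr_const card_ord -[in LHS]mulNr mulr_natr.
    apply: ler_sum => i _.
    have := HK i (x - h *: e_ i); have := HK i x.
    rewrite !ler_norml => /andP[_ H1] /andP[H2 _]; lra.
  have psih : psi x <= h ^+ 2 / a.
    apply: le_trans (potential_le _ a0 _) _.
    by rewrite ler_wpM2r// invr_ge0 ltW.
  apply: (@le_trans _ _ (psi x * - (2 * K * d%:R))); last by rewrite ler_wpM2l.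
  have H1 := ler_wpM2l hc0 psih; have H2 := ler_wpM2l C0 psih.
  lra.
have seg i (t : R) : 0 <= t <= h -> A (x - t *: e_ i).
  move=> /andP[t0 th]; apply: (sqdist_lt_in pmin (x := x)).
  rewrite /sqdist opprB addrC subrK dot_delta; apply: le_lt_trans sh.
  by rewrite ler_pXn2r ?nnegrE// ltW.
have Ax : A x.
  apply: (sqdist_lt_in pmin (x := x)); apply: le_lt_trans sh.
  by rewrite /sqdist subrr -(scale0r 0) dotZl mul0r sqr_ge0.
have Hsum : h * c / 2 <= \sum_i (ut i (x - h *: e_ i) - ut i x).
  apply: (@le_trans _ _ (\sum_i
    (- (h * partial i (fun y => u y 0 i) x) - B * h ^+ 2))).
    rewrite sumrB sumrN -mulr_sumr -/(div u x) Hdiv// sumr_const card_ord.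
    rewrite -[_ *+ d]mulr_natr.
    have := ler_wpM2l (ltW h0) Bh; lra.
  apply: ler_sum => i _; have := HB i x (seg i).
  have A' : A (x - h *: e_ i) by apply: seg; rewrite lexx ltW.
  rewrite /ut !mem_set// ler_norml => /andP[H _]; lra.
have H := ler_wpM2l psi0 Hsum.
have H2 : 0 <= (2 * K * d%:R + h * c / 2) * (h ^+ 2 / a).
  by rewrite mulr_ge0// addr_ge0.
lra.
Qed.

End Estimates.
Section Sum.
Variables (K L B a r c : R) (x0 : V) (Q m : nat).
Hypotheses (K0 : 0 <= K) (L0 : 0 <= L) (HK : forall i x, `|ut i x| <= K).
Hypothesis HL : forall x, `|\sum_i ut i x * (x - p x) 0 i| <= L * s x.
Hypotheses (a0 : 0 < a) (r0 : 0 < r) (c0 : 0 < c) (B0 : 0 <= B) (m0 : (0 < m)%N).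
Let h : R := r / m%:R.
Hypothesis HB : forall i z, (forall t : R, 0 <= t <= h -> A (z - t *: e_ i)) ->
  `|u (z - h *: e_ i) 0 i - u z 0 i
    + h * partial i (fun y => u y 0 i) z| <= B * h ^+ 2.
Hypothesis Hdiv : forall z, A z -> div u z = - c.
Hypothesis Bh : d%:R * (B * h) <= c / 2.
Hypothesis AQ : forall x, A x -> `|x - x0| < Q%:R * r.
Hypothesis Ar : forall x, `|x - x0| < 2 * r -> A x.

Let psi := potential p a.
(** In each direction index 0 lies on the lower face of the box of half-width [Q * r] about [x0],
    index [n] on the upper face and index [n + 1] one mesh beyond. Both ends of the cyclic index
    range are thus outside [A]. *)
Let n := (2 * Q * m)%N.
Let o : V := x0 - const_mx (Q%:R * r).
Let hv : V := const_mx h.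

Let h0 : 0 < h. Proof. by rewrite divr_gt0// ltr0n. Qed.

Let out (x : V) i : Q%:R * r <= `|x 0 i - x0 0 i| -> ~ A x.
Proof.
move=> H /AQ; apply/negP; rewrite -leNgt; apply: le_trans H _.
by have := coord_le_norm (x - x0) i; rewrite !mxE.
Qed.

Let node_coord (k : 'rV['I_n.+2]_d) i :
  node o hv k 0 i = x0 0 i - Q%:R * r + h * (k 0 i)%:R.
Proof. by rewrite !mxE. Qed.

Let hn : h * n%:R = 2 * (Q%:R * r).
Proof.
rewrite /h /n !natrM; field.
by rewrite pnatr_eq0 -lt0n.
Qed.

Let Qr0 : 0 <= Q%:R * r. Proof. by rewrite mulr_ge0// ltW. Qed.

(** The [i]-th coordinates of all four points differ from that of [x0] by at least [Q * r], so the
    points miss [A]. Hence neither [ut] nor [psi] notices the wrap-around. *)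
Let out_shift (T : Type) (g : V -> T) (t0 : T) i (k : 'rV['I_n.+2]_d) :
  (forall x, ~ A x -> g x = t0) -> k 0 i = n.+1 :> nat ->
  [/\ g (node o hv k + hv 0 i *: e_ i - (hv 0 i * n.+2%:R) *: e_ i) = t0,
     g (node o hv k + hv 0 i *: e_ i) = t0,
     g (node o hv k) = t0 &
     g (node o hv k - (hv 0 i * n.+2%:R) *: e_ i) = t0].
Proof.
move=> g0 kn; have hn' := hn; have h0' := h0; have Qr0' := Qr0.
have hvi : hv 0 i = h by rewrite mxE.
have n2 : n.+2%:R = n%:R + 2 :> R by rewrite -!natr1; ring.
have n1 : n.+1%:R = n%:R + 1 :> R by rewrite -!natr1.
have := node_coord k i; rewrite hvi n2 kn n1 !mulrDr hn mulr1.
move: (node o hv k) => z zi.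
have E1 (t : R) : (t *: e_ i) 0 i = t.
  by rewrite mxE [delta_mx _ _ _ _]mxE !eqxx mulr1.
have E2 (x y : V) : (x + y) 0 i = x 0 i + y 0 i by rewrite mxE.
have E3 (x y : V) : (x - y) 0 i = x 0 i - y 0 i by rewrite !mxE.
split; apply: g0; apply: (@out _ i); rewrite ?(E3, E2, E1) zi.
- by rewrite (_ : _ - x0 0 i = - (Q%:R * r)) ?normrN ?ger0_norm//; ring.
- rewrite (_ : _ - x0 0 i = Q%:R * r + 2 * h); last by ring.
  by rewrite ger0_norm; lra.
- rewrite (_ : _ - x0 0 i = Q%:R * r + h); last by ring.
  by rewrite ger0_norm; lra.
- rewrite (_ : _ - x0 0 i = - (Q%:R * r + h)); last by ring.
  by rewrite normrN ger0_norm; lra.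
Qed.

Lemma lattice_sum_eq :
  \sum_(k : 'rV['I_n.+2]_d) \sum_i
     ((ut i (node o hv k) + K) * (psi (node o hv k + h *: e_ i) - psi (node o hv k))
      + K * (psi (node o hv k - h *: e_ i) - psi (node o hv k))) =
  \sum_(k : 'rV['I_n.+2]_d) psi (node o hv k) *
     \sum_i (ut i (node o hv k - h *: e_ i) - ut i (node o hv k)).
Proof.
have psi_out x : ~ A x -> psi x = 0 by exact: potential_out.
have ut_out i x : ~ A x -> ut i x = 0.
  by move=> nAx; rewrite /ut ifF//; apply/negP; rewrite inE.
have hvi i : hv 0 i = h by rewrite mxE.
have := sum_by_parts (fun i => delta_mx 0 i : 'rV['I_n.+2]_d)
  (fun i k => ut i (node o hv k)) (fun k => psi (node o hv k)) K.
rewrite (eq_bigr (fun k : 'rV['I_n.+2]_d => \sum_i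
     ((ut i (node o hv k) + K) * (psi (node o hv k + h *: e_ i) - psi (node o hv k))
      + K * (psi (node o hv k - h *: e_ i) - psi (node o hv k))))) => [->|k _].
  apply: eq_bigr => k _; congr (_ * _); apply: eq_bigr => i _; congr (_ - _).
  rewrite -(hvi i); apply: (node_shiftN (g := ut i)) => k' k'n.
  by have [_ _ -> ->] := out_shift (ut_out i) k'n.
apply: eq_bigr => i _; congr (_ * (_ - _) + _ * (_ - _)); rewrite -(hvi i).
  apply: (node_shift (g := psi)) => k' k'n.
  by have [-> -> _ _] := out_shift psi_out k'n.
apply: (node_shiftN (g := psi)) => k' k'n.
by have [_ _ -> ->] := out_shift psi_out k'n.
Qed.

(** The [m ^ d] nodes in the cube of side [r] with lowest corner [x0] already give this much: a
    point of the complement within less than [r] of such a node would be within [2 * r] of [x0],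
    hence in [A]. The other terms are nonnegative. *)
Lemma lattice_sum_ge :
  (m ^ d)%:R * ln (1 + r ^+ 2 / a) <=
  \sum_(k : 'rV['I_n.+2]_d) psi (node o hv k).
Proof.
have Ax0 : A x0 by apply: Ar; rewrite subrr normr0 mulr_gt0.
have Q0 : (0 < Q)%N.
  by have := AQ Ax0; rewrite subrr normr0 lt0n; case: eqP => // ->;
    rewrite mul0r ltxx.
have qm (j : 'I_m) : (Q * m + j < n.+2)%N.
  rewrite /n !ltnS leqW// -mulnA mul2n -addnn leq_add2l.
  by rewrite (leq_trans (ltnW (ltn_ord j)))// leq_pmull.
(* The offset [Q * m] is the index of [x0] in every direction. *)
pose f (b : 'rV['I_m]_d) : 'rV['I_n.+2]_d := \row_i Ordinal (qm (b 0 i)).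
have finj : injective f.
  move=> b b' /rowP E; apply/rowP => i; have := E i; rewrite !mxE => -[] /addnI.
  exact: val_inj.
have psi0 x : 0 <= psi x by exact: potential_ge0.
rewrite (bigID (mem (f @: [set: 'rV['I_m]_d]%SET)))/= ler_wpDr ?sumr_ge0//.
rewrite big_imset/=; last by move=> b b' _ _; exact: finj.
have -> : (m ^ d)%:R * ln (1 + r ^+ 2 / a) =
    \sum_(b in [set: 'rV['I_m]_d]%SET) ln (1 + r ^+ 2 / a).
  by rewrite sumr_const cardsT card_mx card_ord mul1n mulr_natl.
apply: ler_sum => b _; rewrite /psi /potential.
set x := node _ _ _.
have xr : `|x - x0| <= r.
  apply: norm_le_coord => [|i]; first exact: ltW.
  rewrite !mxE natrD natrM /= mulrDr.
  have m0' : m%:R != 0 :> R by rewrite pnatr_eq0 -lt0n.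
  have -> : x0 0 i - Q%:R * r + (h * (Q%:R * m%:R) + h * (b 0 i)%:R) - x0 0 i =
            h * (b 0 i)%:R by rewrite /h; field.
  rewrite ger0_norm ?(mulr_ge0 (ltW h0))// (_ : r = h * m%:R); last first.
    by rewrite /h divfK.
  by rewrite ler_wpM2l ?(ltW h0)// ler_nat ltnW.
have xp : r <= `|x - p x|.
  rewrite leNgt; apply/negP => H; apply: (@pA x); apply: Ar.
  have -> : p x - x0 = (x - x0) - (x - p x) by rewrite opprB [RHS]addrC addrA subrK.
  apply: le_lt_trans (ler_normB _ _) _.
  by rewrite (_ : 2 * r = r + r) ?ler_ltD//; ring.
rewrite ler_ln ?posrE ?ltr_pwDl ?divr_ge0 ?sqr_ge0 ?dot_ge0 ?(ltW a0)//.
rewrite lerD2l ler_wpM2r ?invr_ge0 ?(ltW a0)//.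
apply: le_trans (normsq_le_dot _).
by rewrite ler_pXn2r ?nnegrE// ltW.
Qed.

(** Summation by parts links the upper and lower estimates at the nodes, whose [h ^+ 2 / a] errors
    combine into [5 * K * d + h * c / 2]. After division by [h * m ^ d], the inequality
    [n + 2 <= (2 * Q + 2) * m] makes the factor in front independent of the mesh. *)
Lemma lattice_bound :
  c / 2 * ln (1 + r ^+ 2 / a) <=
  ((2 * Q + 2) ^ d)%:R * (2 * L + (5 * K * d%:R + h * c / 2) * (h / a)).
Proof.
set X := 2 * L + _.
have X0 : 0 <= X.
  by rewrite addr_ge0 ?mulr_ge0 ?addr_ge0 ?mulr_ge0 ?invr_ge0// ltW.
have upper := ler_sum (index_enum 'rV['I_n.+2]_d)
  (fun k _ => upwind_le K0 L0 HK HL a0 h0 (node o hv k)).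
have lower := ler_sum (index_enum 'rV['I_n.+2]_d)
  (fun k _ => downwind_ge K0 HK a0 h0 (node o hv k) B0 c0 HB Hdiv Bh).
have := le_trans (lower xpredT) (le_trans _ (upper xpredT)).
rewrite -lattice_sum_eq => /(_ (lexx _)).
rewrite sumrB -mulr_sumr !sumr_const card_mx card_ord mul1n.
set N := (n.+2 ^ d)%N => main.
have ln0 : 0 <= ln (1 + r ^+ 2 / a).
  by rewrite ln_ge0// lerDl divr_ge0 ?sqr_ge0// ltW.
have hc0 : 0 <= h * c / 2 by rewrite divr_ge0// mulr_ge0// ltW.
have step : h * c / 2 * ((m ^ d)%:R * ln (1 + r ^+ 2 / a)) <= N%:R * (h * X).
  apply: le_trans (ler_wpM2l hc0 lattice_sum_ge) _.
  move: main; rewrite -[X in _ - X]mulr_natl -[X in _ <= X]mulr_natl.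
  rewrite lerBlDr => /le_trans; apply.
  rewrite -mulrDr ler_wpM2l//.
  by rewrite /X le_eqVlt; apply/orP; left; apply/eqP; field; rewrite gt_eqF.
have NM : N%:R <= ((2 * Q + 2) ^ d)%:R * (m ^ d)%:R :> R.
  rewrite -natrM ler_nat /N -expnMn; case: (posnP d) => [->//|d0].
  rewrite leq_exp2r// mulnDl /n -addn2 leq_add2l mul2n -addnn.
  by rewrite (leq_add m0 m0).
have hm : 0 < h * (m ^ d)%:R by rewrite mulr_gt0// ltr0n expn_gt0 m0.
rewrite -(ler_pM2l hm).
apply: (@le_trans _ _ (N%:R * (h * X))).
  by apply: le_trans step; rewrite le_eqVlt; apply/orP; left; apply/eqP; ring.
have hX : 0 <= h * X by rewrite mulr_ge0// ltW.
apply: le_trans (ler_wpM2r hX NM) _.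
by rewrite le_eqVlt; apply/orP; left; apply/eqP; ring.
Qed.

End Sum.

(** The order of choices matters: the constants of [A] and [u] fix [T], then [a] makes the logarithm
    exceed [T], and the mesh comes last and makes the errors harmless. This contradicts
    [lattice_bound]. *)
Lemma no_constant_source (c : R) (x0 : V) : A x0 -> 0 < c ->
  (forall x, A x -> div u x = - c) -> False.
Proof.
move=> Ax0 c0 Hdiv.
have [L L0 HL] := flux_bound.
have [K K0 HK] := flow_bound.
have [B B0 HB] : exists2 B, 0 <= B & forall i x (h : R), 0 <= h ->
    (forall t : R, 0 <= t <= h -> A (x - t *: e_ i)) ->
    `|u (x - h *: e_ i) 0 i - u x 0 i + h * partial i (fun y => u y 0 i) x|
      <= B * h ^+ 2.
  apply: uniform_bound => [i a b ab Ha x h h0 Hx|i].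
    by apply: le_trans (Ha x h h0 Hx) _; rewrite ler_wpM2r// sqr_ge0.
  have [B _ HB] := Ck_difference_quotient compact_closure (@subset_refl _ _) (Cu i).
  exists B => x h h0 Hx; apply: HB => // t /Hx Axt; split => //.
  exact: subset_closure.
have [e e0 He] : exists2 e : R, 0 < e & forall x, `|x - x0| < e -> A x.
  have /nbhs_ballP[e e0 He] : nbhs x0 A by exact: open_nbhs_nbhs.
  by exists e => // x xe; apply: He; rewrite -ball_normE/= distrC.
pose r := e / 2; have r0 : 0 < r by rewrite divr_gt0.
have Ar x : `|x - x0| < 2 * r -> A x by rewrite mulrC divfK//; exact: He.
have [Q HQ] : exists Q : nat, forall x, A x -> `|x - x0| < Q%:R * r.
  have [M [Mr HM]] := bA.
  exists (Num.bound ((`|M| + 1 + `|x0|) / r)) => x Ax.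
  rewrite -ltr_pdivrMr//; apply: le_lt_trans (archi_boundP _); last first.
    by rewrite divr_ge0 ?addr_ge0// ltW.
  rewrite ler_wpM2r ?invr_ge0 ?(ltW r0)//.
  rewrite (le_trans (ler_normB _ _))// lerD2r (HM (`|M| + 1))//.
  by rewrite (le_lt_trans (ler_norm _))// ltrDl.
pose kappa : R := ((2 * Q + 2) ^ d)%:R.
have k0 : 0 < kappa by rewrite ltr0n expn_gt0 addn_gt0 orbT.
(* [c / 2 * T] is the right side of [lattice_bound] with its error term replaced by 1; since
   [r ^+ 2 / a = expR T], the left side will be strictly larger. *)
pose T := kappa * (2 * L + 1) / (c / 2).
pose a := r ^+ 2 / expR T.
have a0 : 0 < a by rewrite divr_gt0 ?exprn_gt0 ?expR_gt0.
have lnT : T < ln (1 + r ^+ 2 / a).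
  have r2 : 0 < r ^+ 2 by rewrite exprn_gt0.
  rewrite -[X in X < _]expRK ltr_ln ?posrE ?expR_gt0//.
    by rewrite /a invf_div mulrCA divff ?mulr1 ?ltrDr// gt_eqF.
  by rewrite (addr_gt0 ltr01)// (divr_gt0 r2 a0).
(* The first entry gives [h * c <= c], the second the condition [Bh], and the third, together with
   the first, an error term of at most 1. *)
pose h1 := Num.min 1 (Num.min (c / 2 / (d%:R * B + 1)) (a / (5 * K * d%:R + c))).
have dB : 0 < d%:R * B + 1 by rewrite ltr_wpDl ?mulr_ge0.
have Kc : 0 < 5 * K * d%:R + c by rewrite ltr_wpDl ?mulr_ge0.
have h10 : 0 < h1 by rewrite !lt_min ltr01 !divr_gt0 ?exprn_gt0 ?expR_gt0.
pose m := (Num.bound (r / h1)).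
have m0 : (0 < m)%N.
  rewrite -(ltr0n R); apply: le_lt_trans (archi_boundP _).
    exact: divr_ge0 (ltW r0) (ltW h10).
  by rewrite divr_ge0// ltW.
have mr0 : 0 < m%:R :> R by rewrite ltr0n.
have hh : r / m%:R <= h1.
  rewrite ler_pdivrMr// mulrC -ler_pdivrMr//; apply: ltW.
  by apply: archi_boundP; rewrite divr_ge0// ltW.
have h0 : 0 < r / m%:R by rewrite divr_gt0.
move: hh; rewrite !le_min => /and3P[hh1 hh2 hh3].
have Bh : d%:R * (B * (r / m%:R)) <= c / 2.
  rewrite ler_pdivlMr// in hh2; apply: le_trans hh2.
  by rewrite mulrDr mulr1 mulrA mulrC lerDl ltW.
have HBm i z (H : forall t : R, 0 <= t <= r / m%:R -> A (z - t *: e_ i)) :=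
  HB i z (r / m%:R) (ltW h0) H.
have bound := lattice_bound K0 L0 HK HL a0 r0 c0 B0 m0 HBm Hdiv Bh HQ Ar.
suff : c / 2 * ln (1 + r ^+ 2 / a) < c / 2 * ln (1 + r ^+ 2 / a) by rewrite ltxx.
apply: le_lt_trans bound _; rewrite -/kappa.
apply: (@le_lt_trans _ _ (c / 2 * T)); last first.
  have c20 : 0 < c / 2 by rewrite divr_gt0.
  by rewrite (ltr_pM2l c20).
rewrite /T [leRHS]mulrC divfK; last by rewrite gt_eqF// divr_gt0.
rewrite ler_wpM2l ?(ltW k0)// lerD2l mulrA ler_pdivrMr// mul1r.
rewrite ler_pdivlMr// in hh3; apply: le_trans hh3; rewrite mulrC.
rewrite ler_wpM2l ?(ltW h0)// lerD2l.
have : r / m%:R * c <= c by rewrite ler_piMl// ltW.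
lra.
Qed.

End NoFluxDivergence.

(** * Vanishing of a constant divergence under either boundary condition *)

Section ConstantDivergence.
Context {R : realType} {d : nat}.
Local Notation V := 'rV[R]_d.
Local Notation e_ i := (delta_mx 0 i : V).
Implicit Types (A : set V) (f g : V -> R) (u : V -> V).

Lemma Ck_derivable k A f x v : Ck k.+1 A f -> A x -> derivable f x v.
Proof. by move=> Cf Ax; apply: diff_derivable; exact: Ck_differentiable Cf _ Ax. Qed.

Lemma Ck_derivable_partial k A f i x v : open A -> Ck k.+2 A f -> A x ->
  derivable (partial i f) x v.
Proof.
move=> oA Cf Ax; have [g Cg fg] := Ck_partial i Cf.
apply: (near_eq_derivable (f := g)); last exact: Ck_derivable Cg Ax.
have : \forall y \near x, A y by exact: open_nbhs_nbhs.
by apply: filterS => y Ay; rewrite fg.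
Qed.

Lemma partial_lin i a b f g x :
  derivable f x (e_ i) -> derivable g x (e_ i) ->
  partial i (fun y => a * f y + b * g y) x = a * partial i f x + b * partial i g x.
Proof.
move=> df dg; rewrite /partial.
have -> : (fun y => a * f y + b * g y) = (a *: f) + (b *: g) by [].
by rewrite deriveD ?deriveZ//; exact: derivableZ.
Qed.

Lemma differentiable_lin a b f g x : differentiable f x -> differentiable g x ->
  differentiable (fun y => a * f y + b * g y) x.
Proof.
move=> df dg.
have -> : (fun y => a * f y + b * g y) = (a *: f) + (b *: g) by [].
by apply: differentiableD; exact: differentiableZ.
Qed.

Lemma within_lin A a b f g :
  {within A, continuous f} -> {within A, continuous g} ->
  {within A, continuous (fun y => a * f y + b * g y)}.
Proof.
move=> cf cg x; apply: cvgD; apply: cvgM; try exact: cvg_cst.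
  exact: cf.
exact: cg.
Qed.

Lemma Ck_lin k A a b f g : Ck k A f -> Ck k A g ->
  Ck k A (fun y => a * f y + b * g y).
Proof.
elim: k f g => [|k IH] f g Cf Cg.
  by split => //; apply: within_lin; [exact: Ck_within Cf|exact: Ck_within Cg].
split; first by apply: within_lin; [exact: Ck_within Cf|exact: Ck_within Cg].
have df := Ck_differentiable Cf; have dg := Ck_differentiable Cg.
split=> [x Ax|i]; first by apply: differentiable_lin; [exact: df|exact: dg].
have [f' Cf' ff'] := Ck_partial i Cf; have [g' Cg' gg'] := Ck_partial i Cg.
exists (fun y => a * f' y + b * g' y); first exact: IH.
by move=> x Ax; rewrite partial_lin ?ff' ?gg'//;
  [exact: Ck_derivable Cf Ax|exact: Ck_derivable Cg Ax].
Qed.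

Lemma noflux_div_const A u c : (0 < d)%N -> open A -> A !=set0 -> bounded_set A ->
  (forall i, Ck 2 A (fun x => u x 0 i)) ->
  (forall y nu, (closure A `\` A°) y -> outward_normal A y nu ->
    dot (u y) nu = 0) ->
  (forall x, A x -> div u x = c) -> c = 0.
Proof.
move=> d0 oA [x0 Ax0] bA Cu bcu Hdiv.
have [p Hp] : exists p : V -> V, forall x, (~` A) (p x) /\
    forall z, (~` A) z -> sqdist x (p x) <= sqdist x z.
  apply: nearest_point; first exact: open_closedC.
  have [M [Mr HM]] := bA.
  (* A point of the complement: its coordinates exceed the bound on [A], and [0 < d] ensures that
     there is one. *)
  exists (const_mx (`|M| + 2)) => /(HM (`|M| + 1)) H.
  have := coord_le_norm (const_mx (`|M| + 2) : V) (Ordinal d0).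
  rewrite mxE ger0_norm ?addr_ge0// => H1.
  have : `|M| + 2 <= `|M| + 1.
    by apply: le_trans H1 (H _); rewrite (le_lt_trans (ler_norm _))// ltrDl.
  by rewrite lerD2l leNgt ltr1n.
have pA x : ~ A (p x) := (Hp x).1.
have pmin x z : ~ A z -> sqdist x (p x) <= sqdist x z := (Hp x).2 z.
have [c0|c0|//] := ltgtP c 0.
  exfalso; apply: (no_constant_source oA bA pA pmin Cu bcu (c := - c) Ax0).
    by rewrite oppr_gt0.
  by move=> x Ax; rewrite opprK Hdiv.
exfalso; apply: (no_constant_source (u := fun x => - u x) oA bA pA pmin _ _ Ax0 c0).
- move=> i; have -> : (fun x => (- u x) 0 i) = (fun x => (-1) * u x 0 i + 0 * u x 0 i).
    by apply/funext => x; rewrite mxE mul0r addr0 mulN1r.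
  exact: Ck_lin.
- by move=> y nu ? ?; rewrite dotNl bcu// oppr0.
- move=> x Ax; rewrite -(Hdiv x Ax) /div -sumrN; apply: eq_bigr => i _.
  have -> : (fun x => (- u x) 0 i) = (fun x => (-1) * u x 0 i + 0 * u x 0 i).
    by apply/funext => y; rewrite mxE mul0r addr0 mulN1r.
  have du := Ck_derivable (v := e_ i) (Cu i) Ax.
  by rewrite partial_lin// mul0r addr0 mulN1r.
Qed.

(** With mesh [L 0 i / (n + 2)] in direction [i], the difference quotients sum to zero over a
    period, while at each node they equal [- c] up to a multiple of the mesh. Hence [c] times
    [n + 2] is bounded in [n]. *)
Lemma periodic_div_const (L : V) u c : (forall i, 0 < L 0 i) -> Defs.periodic L u ->
  (forall i, Ck 2 [set: V] (fun x => u x 0 i)) ->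
  (forall x, div u x = c) -> c = 0.
Proof.
move=> L0 perL Cu Hdiv.
(* The nodes have norm at most that of [L], and so have the backward shifts: this ball contains
   every segment used. *)
pose K := [set z : V | `|0 - z| <= 2 * `|L|].
have cK : compact K.
  apply: bounded_closed_compact; last exact: closed_closed_ball_.
  exists (2 * `|L|); split; first exact: num_real.
  by move=> M HM z; rewrite /K/= sub0r normrN => H; apply: le_trans H (ltW HM).
have [B B0 HB] : exists2 B, 0 <= B & forall i x (h : R), 0 <= h ->
    (forall t : R, 0 <= t <= h -> K (x - t *: e_ i)) ->
    `|u (x - h *: e_ i) 0 i - u x 0 i + h * partial i (fun y => u y 0 i) x|
      <= B * h ^+ 2.
  apply: uniform_bound => [i a b ab Ha x h h0 Hx|i].
    by apply: le_trans (Ha x h h0 Hx) _; rewrite ler_wpM2r// sqr_ge0.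
  have KT : K `<=` closure [set: V] by move=> x _; exact: subset_closure.
  have [B _ HB] := Ck_difference_quotient cK KT (Cu i).
  by exists B => x h h0 Hx; apply: HB => // t /Hx.
suff H (n : nat) : `|c| * n.+2%:R <= d%:R * (B * `|L|).
  apply/eqP; rewrite -normr_le0 leNgt; apply/negP => c0.
  set X := d%:R * (B * `|L|) in H.
  have X0 : 0 <= X / `|c| by rewrite !mulr_ge0 ?invr_ge0.
  have := H (Num.bound (X / `|c|)).
  rewrite leNgt => /negP; apply; rewrite mulrC -ltr_pdivrMr//.
  by apply: lt_le_trans (archi_boundP X0) _; rewrite ler_nat -addn2 leq_addr.
pose hv : V := n.+2%:R^-1 *: L.
have n0 : 0 < n.+2%:R :> R by [].
have hvE i : hv 0 i = L 0 i / n.+2%:R by rewrite mxE mulrC.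
have hvL i : hv 0 i * n.+2%:R = L 0 i by rewrite hvE divfK.
have hv0 i : 0 < hv 0 i by rewrite hvE divr_gt0.
have hvle i : hv 0 i <= `|L| / n.+2%:R.
  by rewrite hvE ler_wpM2r ?invr_ge0// (le_trans (ler_norm _) (coord_le_norm _ _)).
pose nd := node 0 hv : 'rV['I_n.+2]_d -> V.
have ndK k i (t : R) : 0 <= t <= hv 0 i -> K (nd k - t *: e_ i).
  move=> /andP[t0 th]; rewrite /K/= sub0r normrN mulr2n mulrDl mul1r.
  apply: le_trans (ler_normB _ _) _; apply: lerD.
    apply: norm_le_coord => // j.
    have -> : nd k 0 j = hv 0 j * (k 0 j)%:R by rewrite /nd /node !mxE add0r.
    rewrite ger0_norm ?(mulr_ge0 (ltW (hv0 j)))//.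
    apply: le_trans (le_trans (ler_norm _) (coord_le_norm L j)).
    by rewrite -hvL ler_wpM2l ?(ltW (hv0 j))// ler_nat ltnW.
  apply: norm_le_coord => // j; rewrite mxE [delta_mx _ _ _ _]mxE eqxx/=.
  have [_|_] := eqVneq j i; last by rewrite mulr0 normr0.
  rewrite mulr1 ger0_norm// (le_trans th)// (le_trans (hvle i))//.
  by rewrite ler_pdivrMr// ler_peMr// ler1n.
pose S k := \sum_i (hv 0 i)^-1 * (u (nd k - hv 0 i *: e_ i) 0 i - u (nd k) 0 i).
have S0 : \sum_k S k = 0.
  (* With the constant test function 1 and [K = 0], the left side vanishes and the right side is the
     sum of [S]. *)
  have := @sum_by_parts R _ d (fun i => delta_mx 0 i : 'rV['I_n.+2]_d)
    (fun i k => (hv 0 i)^-1 * u (nd k) 0 i) (fun=> 1) 0.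
  rewrite big1 => [E|k _]; last first.
    by rewrite big1 // => i _; rewrite !subrr !mulr0 addr0.
  have sh i k : u (nd (k - delta_mx 0 i)) 0 i = u (nd k - hv 0 i *: e_ i) 0 i.
    apply: (node_shiftN (g := fun x => u x 0 i)) => k' _.
    by rewrite hvL -[in LHS](subrK (L 0 i *: e_ i) (node 0 hv k')) perL.
  rewrite [RHS]E; apply: eq_bigr => k _; rewrite mul1r; apply: eq_bigr => i _.
  by rewrite mulrBr -sh.
have Sc k : `|S k + c| <= d%:R * (B * (`|L| / n.+2%:R)).
  rewrite -(Hdiv (nd k)) /S /div -big_split/=.
  apply: le_trans (ler_norm_sum _ _ _) _.
  have -> : d%:R * (B * (`|L| / n.+2%:R)) = \sum_(i < d) B * (`|L| / n.+2%:R).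
    by rewrite sumr_const card_ord mulr_natl.
  apply: ler_sum => i _.
  have -> : (hv 0 i)^-1 * (u (nd k - hv 0 i *: e_ i) 0 i - u (nd k) 0 i)
       + partial i (fun y => u y 0 i) (nd k) =
     (hv 0 i)^-1 * (u (nd k - hv 0 i *: e_ i) 0 i - u (nd k) 0 i
       + hv 0 i * partial i (fun y => u y 0 i) (nd k)).
    by field; rewrite gt_eqF.
  rewrite normrM ger0_norm ?invr_ge0 ?(ltW (hv0 i))//.
  rewrite ler_pdivrMl//; apply: le_trans (HB _ _ _ (ltW (hv0 i)) (ndK k i)) _.
  by rewrite expr2 mulrCA ler_wpM2l ?(ltW (hv0 i))// ler_wpM2l.
have : `|\sum_k (S k + c)| <= \sum_(k : 'rV['I_n.+2]_d) d%:R * (B * (`|L| / n.+2%:R)).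
  by apply: le_trans (ler_norm_sum _ _ _) _; apply: ler_sum => k _; exact: Sc.
rewrite big_split/= S0 add0r !sumr_const normrMn -[leLHS]mulr_natl -[leRHS]mulr_natl.
have N0 : 0 < #|{: 'rV['I_n.+2]_d}|%:R :> R.
  by rewrite ltr0n card_mx card_ord expn_gt0.
by rewrite (ler_pM2l N0) !mulrA ler_pdivlMr.
Qed.
End ConstantDivergence.

(** * Functions with vanishing gradient *)

Section ZeroGradient.
Context {R : realType} {d : nat}.
Local Notation V := 'rV[R]_d.
Implicit Types (A : set V) (f : V -> R).

Lemma line_const k A f x v : Ck k.+1 A f ->
  (forall z i, A z -> partial i f z = 0) ->
  (forall t : R, 0 < t <= 1 -> A (x + t *: v)) -> f (x + v) = f x.
Proof.
move=> Cf f0 Axv.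
have [t /andP[t0 t1]] := line_mvt (Ck_within Cf) (Ck_differentiable Cf) Axv.
rewrite big1 => [/eqP|j _]; first by rewrite subr_eq0 => /eqP.
by rewrite f0 ?mulr0//; apply: Axv; rewrite t0 ltW.
Qed.

Lemma zero_gradient_const k A f : open A -> connected A -> Ck k.+1 A f ->
  (forall z i, A z -> partial i f z = 0) ->
  forall x y, A x -> A y -> f x = f y.
Proof.
move=> oA cA Cf f0 x y Ax Ay.
(* As [f] is constant on balls inside [A], any condition on its value is open; the level of [x] and
   its complement in [A] are the two instances needed for connectedness. *)
have oP (P : R -> Prop) : open (A `&` [set z | P (f z)]).
  rewrite openE => z [Az Pz].
  have /nbhs_ballP[e e0 He] : nbhs z A by exact: open_nbhs_nbhs.
  apply/nbhs_ballP; exists e => // w; rewrite -ball_normE/= => zw.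
  have Azw (t : R) : 0 < t <= 1 -> A (z + t *: (w - z)).
    move=> /andP[t0 t1]; apply: He; rewrite -ball_normE/= opprD addrA subrr add0r.
    rewrite normrN normrZ gtr0_norm// distrC; apply: le_lt_trans zw.
    by rewrite ler_piMl.
  have := line_const Cf f0 Azw; rewrite addrC subrK => fw.
  split; last by rewrite /= fw.
  by have := Azw 1; rewrite scale1r addrC subrK; apply; rewrite ltr01 lexx.
have E : A `&` [set z | f z = f x] = A.
  apply: cA; first by exists x.
    exists (A `&` [set z | f z = f x]); first exact: (oP (fun t => t = f x)).
    by rewrite setIA setIid.
  exists (~` (A `&` [set z | f z <> f x])).
    exact: (open_closedC (oP (fun t => t <> f x))).
  apply/seteqP; split=> z [Az /= fz]; split => //; first by move=> [].
  by apply: contrapT => H; apply: fz.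
by move: Ay; rewrite -E => -[_ /= ->].
Qed.
End ZeroGradient.

(** * Uniqueness of the coefficients of an expansion in [eps] *)

Section Expansions.
Context {R : realType}.

Lemma cvg_at_right0_eq (f g : R -> R) (l l' : R) :
  f eps @[eps --> 0^'+] --> l -> g eps @[eps --> 0^'+] --> l' ->
  (forall eps, 0 < eps -> f eps = g eps) -> l = l'.
Proof.
move=> fl gl fg; apply: (cvg_unique (@norm_hausdorff _ R^o) _ gl).
apply: cvg_trans fl; apply: near_eq_cvg; near=> eps.
by apply: fg; near: eps; exact: nbhs_right_gt.
Unshelve. all: end_near. Qed.

(** Multiplying by [eps ^+ 2] and letting [eps] tend to 0 identifies [a]; with that term gone,
    multiplying by [eps] identifies [b], and the plain limit then gives [c]. *)
Lemma has_expansion_unique (f g : R -> R) (alpha l a b c : R) :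
  (forall eps, 0 < eps -> f eps = eps ^- 2 * alpha + g eps) ->
  g eps @[eps --> 0^'+] --> l ->
  has_expansion (W := R^o) f a b c -> [/\ a = alpha, b = 0 & c = l].
Proof.
move=> fE gl Hf.
have e1 : (eps : R) @[eps --> 0^'+] --> (0 : R).
  by apply: cvg_at_right_filter; exact: cvg_id.
have {}Hf : eps ^- 2 * (alpha - a) - eps^-1 * b + (g eps - c) @[eps --> 0^'+] --> (0 : R).
  apply: cvg_trans Hf; apply: near_eq_cvg; near=> eps.
  rewrite fE; last by near: eps; exact: nbhs_right_gt.
  by rewrite /GRing.scale/=; ring.
have gc : g eps - c @[eps --> 0^'+] --> l - c by apply: cvgB => //; exact: cvg_cst.
have H2 : eps ^+ 2 * (eps ^- 2 * (alpha - a) - eps^-1 * b + (g eps - c))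
    @[eps --> 0^'+] --> (0 : R) ^+ 2 * 0.
  by apply: cvgM => //; apply: cvgM.
have aE : a = alpha.
  have H3 : (alpha - a) - eps * b + eps ^+ 2 * (g eps - c)
     @[eps --> 0^'+] --> (alpha - a) - 0 * b + 0 ^+ 2 * (l - c).
    apply: cvgD; last by apply: cvgM => //; apply: cvgM.
    by apply: cvgB; [exact: cvg_cst|apply: cvgM => //; exact: cvg_cst].
  have : alpha - a - 0 * b + 0 ^+ 2 * (l - c) = 0 ^+ 2 * 0.
    apply: (cvg_at_right0_eq H3 H2) => eps e0.
    by field; rewrite gt_eqF.
  by rewrite expr2 !mul0r subr0 addr0 => /eqP; rewrite subr_eq0 => /eqP.
have H1 : eps * (- eps^-1 * b + (g eps - c)) @[eps --> 0^'+] --> (0 : R) * 0.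
  apply: cvgM => //; apply: cvg_trans Hf; apply: near_eq_cvg; near=> eps.
  by rewrite aE; ring.
have bE : b = 0.
  have H3 : - b + eps * (g eps - c) @[eps --> 0^'+] --> - b + 0 * (l - c).
    by apply: cvgD; [exact: cvg_cst|exact: cvgM].
  have : - b + 0 * (l - c) = 0 * 0.
    apply: (cvg_at_right0_eq H3 H1) => eps e0.
    by field; rewrite gt_eqF.
  by rewrite !mul0r addr0 => /eqP; rewrite oppr_eq0 => /eqP.
split => //.
have : l - c = 0.
  apply: (cvg_at_right0_eq gc Hf) => eps e0.
  by rewrite aE bE; ring.
by move=> /eqP; rewrite subr_eq0 => /eqP.
Unshelve. all: end_near. Qed.

Lemma same_coefficients_eq (f f' g g' : R -> R) (alpha alpha' l l' : R) :
  (forall eps, 0 < eps -> f eps = eps ^- 2 * alpha + g eps) ->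
  g eps @[eps --> 0^'+] --> l ->
  (forall eps, 0 < eps -> f' eps = eps ^- 2 * alpha' + g' eps) ->
  g' eps @[eps --> 0^'+] --> l' ->
  same_coefficients (W := R^o) f f' -> alpha = alpha' /\ l = l'.
Proof.
move=> fE gl f'E g'l [a [b [c [Hf Hf']]]].
have [<- _ <-] := has_expansion_unique fE gl Hf.
by have [<- _ <-] := has_expansion_unique f'E g'l Hf'.
Qed.

Lemma same_coefficients_coord d (f f' : R -> 'rV[R]_d) i :
  same_coefficients f f' ->
  same_coefficients (W := R^o) (fun eps => f eps 0 i) (fun eps => f' eps 0 i).
Proof.
have coord (h : R -> 'rV[R]_d) a b c : has_expansion h a b c ->
    has_expansion (W := R^o) (fun eps => h eps 0 i) (a 0 i) (b 0 i) (c 0 i).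
  move=> H; rewrite /has_expansion.
  rewrite /has_expansion in H.
  have H1 := @coord_continuous R 1 d 0 i 0.
  have := @cvg_comp _ _ _ _ (fun z : 'rV[R]_d => z 0 i) _ _ _ H H1.
  rewrite mxE; apply: cvg_trans; apply: near_eq_cvg; near=> eps.
  by rewrite /= !mxE.
by move=> [a [b [c [/coord H /coord H']]]]; exists (a 0 i), (b 0 i), (c 0 i).
Unshelve. all: end_near. Qed.

End Expansions.

(** * Families of functions converging with their derivatives *)

Section Families.
Context {R : realType} {d : nat}.
Local Notation V := 'rV[R]_d.
Local Notation e_ i := (delta_mx 0 i : V).
Variables (A : set V) (oA : open A).
Implicit Types (F H : R -> V -> R) (f g : V -> R).

(* The range of eps may depend on x, and the neighbourhood of x on eps: this is
   what positivity of rho0 + eps^2 rho2 provides without a uniform bound. *)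
Definition germ_prop (P : R -> V -> Prop) :=
  forall x, A x -> \forall eps \near (0 : R)^'+, \forall y \near x, P eps y.

Definition axis_derivable f x := forall i, derivable f x (e_ i).

(** Convergence of all partial derivatives up to order [k], pointwise in [x]: the identities of the
    scheme are pointwise, and this notion is stable under sums, products and powers, so Taylor
    expansions are never written out. *)
Fixpoint converges (k : nat) F g : Prop :=
  (forall x, A x -> F eps x @[eps --> 0^'+] --> g x) /\
  if k is k'.+1 then
    [/\ forall x, A x -> axis_derivable g x,
        germ_prop (fun eps => axis_derivable (F eps)) &
        forall i, converges k' (fun eps => partial i (F eps)) (partial i g)]
  else True.

Lemma germ_propS (P Q : R -> V -> Prop) :
  (forall eps x, 0 < eps -> A x -> P eps x -> Q eps x) ->
  germ_prop P -> germ_prop Q.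
Proof.
move=> PQ HP x Ax; have {}HP := HP x Ax; near=> eps.
have e0 : 0 < eps by near: eps; exact: nbhs_right_gt.
have HPe : \forall y \near x, P eps y by near: eps.
have HA : \forall y \near x, A y by exact: open_nbhs_nbhs.
by near=> y; apply: PQ => //; near: y.
Unshelve. all: end_near. Qed.

Lemma germ_propI (P Q : R -> V -> Prop) : germ_prop P -> germ_prop Q ->
  germ_prop (fun eps y => P eps y /\ Q eps y).
Proof.
move=> HP HQ x Ax; have {}HP := HP x Ax; have {}HQ := HQ x Ax; near=> eps.
have HPe : \forall y \near x, P eps y by near: eps.
have HQe : \forall y \near x, Q eps y by near: eps.
by near=> y; split; near: y.
Unshelve. all: end_near. Qed.

Lemma germ_propT (P : R -> V -> Prop) :
  (forall eps x, 0 < eps -> A x -> P eps x) -> germ_prop P.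
Proof.
move=> H; apply: (@germ_propS (fun _ _ => True)) => [eps x e0 Ax _|x Ax].
  exact: H.
by near=> eps; near=> y.
Unshelve. all: end_near. Qed.

(** A derivative depends on values nearby, so an equality passes to partial derivatives near [x]
    only if it holds around every point near [x]. *)
Lemma germ_prop_join (P : R -> V -> Prop) : germ_prop P ->
  germ_prop (fun eps x => \forall y \near x, P eps y).
Proof.
move=> HP x Ax; have {}HP := HP x Ax; near=> eps; apply: near_join.
by near: eps.
Unshelve. all: end_near. Qed.

Lemma near_eq_partial i f g x : (\forall y \near x, f y = g y) ->
  partial i f x = partial i g x.
Proof. exact: near_eq_derive. Qed.

Lemma near_eq_axis_derivable f g x : (\forall y \near x, f y = g y) ->
  axis_derivable f x -> axis_derivable g x.
Proof. by move=> fg df i; apply: near_eq_derivable (df i). Qed.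

Lemma eq_partial_in i f g : (forall x, A x -> f x = g x) ->
  forall x, A x -> partial i f x = partial i g x.
Proof.
move=> fg x Ax; apply: near_eq_partial.
have : \forall y \near x, A y by exact: open_nbhs_nbhs.
by apply: filterS => y; exact: fg.
Qed.

Lemma converges_ext k F H f g : (forall x, A x -> f x = g x) ->
  germ_prop (fun eps y => F eps y = H eps y) ->
  converges k F f -> converges k H g.
Proof.
elim: k F H f g => [|k IH] F H f g fg FH [Ff].
  move=> _; split => // x Ax; rewrite -fg//; apply: cvg_trans (Ff x Ax).
  apply: near_eq_cvg; have := FH x Ax; apply: filterS => eps.
  by move/nbhs_singleton => ->.
move=> [df dF pF]; split.
  move=> x Ax; rewrite -fg//; apply: cvg_trans (Ff x Ax).
  apply: near_eq_cvg; have := FH x Ax; apply: filterS => eps.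
  by move/nbhs_singleton => ->.
split.
- move=> x Ax; apply: near_eq_axis_derivable (df x Ax).
  have : \forall y \near x, A y by exact: open_nbhs_nbhs.
  by apply: filterS => y; exact: fg.
- apply: germ_propS (germ_propI (germ_prop_join FH) dF) => eps x _ _ [].
  exact: near_eq_axis_derivable.
- move=> i; apply: IH (pF i); first exact: eq_partial_in.
  by apply: germ_propS (germ_prop_join FH) => eps x _ _; exact: near_eq_partial.
Qed.

Lemma converges0 k F f : converges k F f ->
  forall x, A x -> F eps x @[eps --> 0^'+] --> f x.
Proof. by case: k => [|k] []. Qed.

Lemma convergesW k F f : converges k.+1 F f -> converges k F f.
Proof.
elim: k F f => [|k IH] F f [Ff [df dF pF]]; first by split.
by split => //; split => // i; apply: IH; exact: pF.
Qed.

Lemma converges_partial k F f i : converges k.+1 F f ->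
  converges k (fun eps => partial i (F eps)) (partial i f).
Proof. by move=> [_ [_ _ pF]]; exact: pF. Qed.

Lemma converges_scalar k (phi : R -> R) (l : R) :
  phi eps @[eps --> 0^'+] --> l ->
  converges k (fun eps _ => phi eps) (fun=> l).
Proof.
elim: k phi l => [|k IH] phi l phil; first by split.
have p0 i (c : R) : partial i (fun=> c) = (fun=> 0) :> (V -> R).
  by apply/funext => x; exact: derive_cst.
split => //; split.
- by move=> x _ i; exact: derivable_cst.
- by apply: germ_propT => eps x _ _ i; exact: derivable_cst.
- move=> i; rewrite p0; apply: (@converges_ext k (fun _ _ => 0) _ (fun=> 0)) => //.
    by apply: germ_propT => eps x _ _; rewrite p0.
  by apply: IH; exact: cvg_cst.
Qed.

Lemma converges_const k f : Ck k A f -> converges k (fun=> f) f.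
Proof.
elim: k f => [|k IH] f Cf; first by split=> // x _; exact: cvg_cst.
have df : forall x, A x -> axis_derivable f x.
  by move=> x Ax i; apply: diff_derivable; exact: Ck_differentiable Cf _ Ax.
split; first by move=> x _; exact: cvg_cst.
split => //; first by apply: germ_propT => eps x _; exact: df.
move=> i; have [g Cg fg] := Ck_partial i Cf.
apply: converges_ext (IH g Cg) => [x Ax|]; first by rewrite fg.
by apply: germ_propT => eps x _ Ax; rewrite fg.
Qed.

Lemma convergesD k F H f g : converges k F f -> converges k H g ->
  converges k (fun eps x => F eps x + H eps x) (fun x => f x + g x).
Proof.
elim: k F H f g => [|k IH] F H f g [Ff +] [Hg].
  by move=> _ _; split => // x Ax; apply: cvgD; [exact: Ff|exact: Hg].
move=> [df dF pF] [dg dH pH]; split.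
  by move=> x Ax; apply: cvgD; [exact: Ff|exact: Hg].
split.
- by move=> x Ax i; exact: derivableD (df x Ax i) (dg x Ax i).
- apply: germ_propS (germ_propI dF dH) => eps x _ _ [d1 d2] i.
  exact: derivableD (d1 i) (d2 i).
- move=> i; apply: converges_ext (IH _ _ _ _ (pF i) (pH i)) => [x Ax|].
    by rewrite /partial (deriveD (df x Ax i) (dg x Ax i)).
  apply: germ_propS (germ_propI dF dH) => eps x _ _ [d1 d2].
  by rewrite /partial (deriveD (d1 i) (d2 i)).
Qed.

Lemma convergesM k F H f g : converges k F f -> converges k H g ->
  converges k (fun eps x => F eps x * H eps x) (fun x => f x * g x).
Proof.
elim: k F H f g => [|k IH] F H f g cF cH.
  split => // x Ax; apply: cvgM; [exact: converges0 cF _ Ax|].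
  exact: converges0 cH _ Ax.
have [_ [df dF pF]] := cF; have [_ [dg dH pH]] := cH; split.
  by move=> x Ax; apply: cvgM; [exact: converges0 cF _ Ax|exact: converges0 cH _ Ax].
split.
- by move=> x Ax i; exact: derivableM (df x Ax i) (dg x Ax i).
- apply: germ_propS (germ_propI dF dH) => eps x _ _ [d1 d2] i.
  exact: derivableM (d1 i) (d2 i).
- move=> i.
  apply: converges_ext (convergesD (IH _ _ _ _ (convergesW cF) (pH i))
                                   (IH _ _ _ _ (convergesW cH) (pF i))) => [x Ax|].
    exact: esym (deriveM (df x Ax i) (dg x Ax i)).
  apply: germ_propS (germ_propI dF dH) => eps x _ _ [d1 d2].
  exact: esym (deriveM (d1 i) (d2 i)).
Qed.

Lemma converges_sum k (F : 'I_d -> R -> V -> R) (f : 'I_d -> V -> R) :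
  (forall j, converges k (F j) (f j)) ->
  converges k (fun eps x => \sum_j F j eps x) (fun x => \sum_j f j x).
Proof.
move=> Ff; elim: (index_enum 'I_d) => [|j r IH].
  under [X in converges _ X _]eq_fun do under eq_fun do rewrite big_nil.
  under [X in converges _ _ X]eq_fun do rewrite big_nil.
  by apply: converges_scalar; exact: cvg_cst.
under [X in converges _ X _]eq_fun do under eq_fun do rewrite big_cons.
under [X in converges _ _ X]eq_fun do rewrite big_cons.
exact: convergesD.
Qed.

(** Restricted to the line through [x] with direction [v], this is the chain rule in one
    variable. *)
Lemma derive_powR f x v (a : R) : derivable f x v -> 0 < f x ->
  derivable (fun y => f y `^ a) x v /\
  'D_v (fun y => f y `^ a) x = a * f x `^ (a - 1) * 'D_v f x.
Proof.
move=> /derivable1P df fx.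
pose phi (t : R) := f (t *: v + x).
have phi0 : phi 0 = f x by rewrite /phi scale0r add0r.
have dp : is_derive (phi 0) 1 (fun t : R => t `^ a) (a * phi 0 `^ (a - 1)).
  by rewrite phi0; exact: is_derive1_powR.
have D (g : V -> R) : 'D_v g x = derive1 (fun t : R => g (t *: v + x)) 0.
  have E : (fun t : R => t^-1 *: (g (t *: v + x) - g x)) =
      (fun t : R => t^-1 *: (g ((t + 0) *: v + x) - g (0 *: v + x))).
    by apply/funext => t; rewrite addr0 scale0r add0r.
  by rewrite /derive E.
split.
  apply/derivable1P/derivable1_diffP.
  apply: (differentiable_comp (f := phi) (g := (fun t : R => t `^ a))).
    exact/derivable1_diffP.
  by apply/derivable1_diffP.
rewrite !D -/phi (derive1_comp (f := phi) (g := (fun t : R => t `^ a)))//.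
by rewrite derive1E derive_val phi0.
Qed.

Lemma cvg_powR (F : R -> R) (l a : R) : 0 < l ->
  F eps @[eps --> 0^'+] --> l -> F eps `^ a @[eps --> 0^'+] --> l `^ a.
Proof.
move=> l0 Fl; have C : {for l, continuous (fun t : R => t `^ a)}.
  apply/differentiable_continuous/derivable1_diffP.
  by apply: derivable_powR; rewrite in_itv/= andbT.
exact: (@cvg_comp _ _ _ _ (fun t : R => t `^ a) _ _ _ Fl C).
Qed.

Lemma converges_powR k F f (a : R) : (forall x, A x -> 0 < f x) ->
  germ_prop (fun eps x => 0 < F eps x) -> converges k F f ->
  converges k (fun eps x => F eps x `^ a) (fun x => f x `^ a).
Proof.
(* The induction generalises [a] because differentiation lowers the exponent by one. *)
move=> f0 F0; elim: k F f a f0 F0 => [|k IH] F f a f0 F0 cF.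
  by split=> // x Ax; apply: cvg_powR (f0 x Ax) _; exact: converges0 cF _ Ax.
have [_ [df dF pF]] := cF; split.
  by move=> x Ax; apply: cvg_powR (f0 x Ax) _; exact: converges0 cF _ Ax.
split.
- by move=> x Ax i; apply: (derive_powR _ _ _).1 => //; [exact: df|exact: f0].
- apply: germ_propS (germ_propI dF F0) => eps x _ _ [d1 d2] i.
  by apply: (derive_powR _ _ _).1.
- move=> i.
  apply: converges_ext (convergesM (convergesM (converges_scalar k (cvg_cst a))
    (IH _ _ (a - 1) f0 F0 (convergesW cF))) (pF i)) => [x Ax|].
    by rewrite /partial (derive_powR _ _ _).2//; [exact: df|exact: f0].
  apply: germ_propS (germ_propI dF F0) => eps x _ _ [d1 d2].
  by rewrite /partial (derive_powR _ _ _).2.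
Qed.

End Families.

(** * The leading-order coefficients of the scheme *)

Section LimitScheme.
Context {R : realType} {d : nat}.
Local Notation V := 'rV[R]_d.
Local Notation e_ i := (delta_mx 0 i : V).
Variables (A : set V) (oA : open A).

Lemma sqr_cvg0 : (eps : R) ^+ 2 @[eps --> 0^'+] --> (0 : R).
Proof.
have e1 : (eps : R) @[eps --> 0^'+] --> (0 : R).
  by apply: cvg_at_right_filter; exact: cvg_id.
by rewrite -[X in _ --> X](mulr0 0); exact: cvgM.
Qed.

Lemma tensorE (v w : V) i j : tensor v w i j = v 0 i * w 0 j.
Proof. by rewrite mxE big_ord1 mxE. Qed.

Section State.
Variables (s : multiscale R d) (gamma dt : R).
Hypotheses (C0 : Ck 2 A (rho0 s)) (C2 : Ck 2 A (rho2 s)).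
Hypothesis Cu0 : forall i, Ck 2 A (fun x => u0 s x 0 i).
Hypothesis Cu1 : forall i, Ck 2 A (fun x => u1 s x 0 i).
Hypothesis pos : forall x, A x -> 0 < rho0 s x.

Lemma density_converges : converges A 2 (density s) (rho0 s).
Proof.
apply: (converges_ext oA _ _ (convergesD oA (converges_const oA C0)
  (convergesM oA (converges_scalar oA 2 sqr_cvg0) (converges_const oA C2)))).
  by move=> x _; rewrite mul0r addr0.
by apply: (germ_propT oA).
Qed.

Lemma velocity_converges i :
  converges A 2 (fun eps x => velocity s eps x 0 i) (fun x => u0 s x 0 i).
Proof.
have e1 : (eps : R) @[eps --> 0^'+] --> (0 : R).
  by apply: cvg_at_right_filter; exact: cvg_id.
apply: (converges_ext oA _ _ (convergesD oA (converges_const oA (Cu0 i))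
  (convergesM oA (converges_scalar oA 2 e1) (converges_const oA (Cu1 i))))).
  by move=> x _; rewrite mul0r addr0.
by apply: (germ_propT oA) => eps x _ _; rewrite !mxE.
Qed.

Lemma density_gt0 : germ_prop A (fun eps x => 0 < density s eps x).
Proof.
move=> x Ax; have lim := converges0 density_converges Ax.
have dpos : \forall eps \near (0 : R)^'+, 0 < density s eps x.
  by apply: (cvgr_gt (rho0 s x)) => //; exact: pos.
apply: filterS dpos => eps dx.
have cont : {for x, continuous (density s eps)}.
  apply: differentiable_continuous.
  have -> : density s eps = fun y => 1 * rho0 s y + eps ^+ 2 * rho2 s y.
    by apply/funext => y; rewrite mul1r.
  by apply: differentiable_lin; [exact: Ck_differentiable C0 _ Ax|
                                 exact: Ck_differentiable C2 _ Ax].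
exact: (@cvgr_gt _ _ (nbhs x) _ (density s eps) (density s eps x) cont 0 dx).
Qed.

Lemma partial_density i eps x : A x -> partial i (density s eps) x =
  partial i (rho0 s) x + eps ^+ 2 * partial i (rho2 s) x.
Proof.
move=> Ax; have -> : density s eps = fun y => 1 * rho0 s y + eps ^+ 2 * rho2 s y.
  by apply/funext => y; rewrite mul1r.
rewrite partial_lin ?mul1r//; first exact: Ck_derivable C0 Ax.
exact: Ck_derivable C2 Ax.
Qed.

(** The order 0 coefficient of [qhat]: when [rho0] has zero gradient, the explicit pressure
    contributes [p'(rho0) - 1] times the gradient of [rho2]. *)
Definition qhat0 i (x : V) : R :=
  rho0 s x * u0 s x 0 i
  - dt * (\sum_j partial j (fun y => rho0 s y * (u0 s y 0 i * u0 s y 0 j)) x)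
  - dt * ((gamma * rho0 s x `^ (gamma - 1) - 1) * partial i (rho2 s) x).

Hypothesis grad0 : forall x i, A x -> partial i (rho0 s) x = 0.

(** The singular factor cancels exactly for each [eps], since the gradient of the density is
    [eps ^+ 2] times that of [rho2]. *)
Lemma partial_pressure i eps x : A x -> 0 < eps -> 0 < density s eps x ->
  dt / eps ^+ 2 *
    partial i (fun y => pressure gamma (density s eps y) - density s eps y) x =
  dt * ((gamma * density s eps x `^ (gamma - 1) - 1) * partial i (rho2 s) x).
Proof.
move=> Ax e0 D0.
have dD : derivable (density s eps) x (e_ i).
  apply: diff_derivable.
  have -> : density s eps = fun y => 1 * rho0 s y + eps ^+ 2 * rho2 s y.
    by apply/funext => y; rewrite mul1r.
  by apply: differentiable_lin; [exact: Ck_differentiable C0 _ Ax|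
                                 exact: Ck_differentiable C2 _ Ax].
have [dP PE] := derive_powR gamma dD D0.
have -> : partial i (fun y => pressure gamma (density s eps y) - density s eps y) x
  = gamma * density s eps x `^ (gamma - 1) * partial i (density s eps) x
    - partial i (density s eps) x.
  by rewrite -PE; exact: (deriveB dP dD).
rewrite partial_density// grad0// add0r.
by field; rewrite gt_eqF.
Qed.

Lemma qhat_converges i : converges A 1
  (fun eps x => qhat gamma dt eps (density s eps) (momentum s eps) x 0 i)
  (qhat0 i).
Proof.
have cst (l : R) : converges A 1 (fun _ _ => l) (fun=> l).
  by apply: converges_scalar => //; exact: cvg_cst.
have cD := density_converges; have cw := velocity_converges.
have cF := convergesM oA (convergesW cD) (convergesW (cw i)).
have cT := convergesM oA (cst (- dt)) (converges_sum oA (fun j =>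
  converges_partial j (convergesM oA cD (convergesM oA (cw i) (cw j))))).
have cR : converges A 1 (fun=> partial i (rho2 s)) (partial i (rho2 s)).
  exact: converges_partial (converges_const oA C2).
have cP := convergesM oA (cst (- dt)) (convergesM oA
  (convergesD oA (convergesM oA (cst gamma)
     (converges_powR oA (gamma - 1) pos density_gt0 (convergesW cD)))
  (cst (- 1))) cR).
apply: (converges_ext oA _ _ (convergesD oA (convergesD oA cF cT) cP)).
  by move=> x Ax; rewrite /qhat0 !mulNr.
apply: (germ_propS oA) density_gt0 => eps x e0 Ax Dx.
rewrite /qhat 2![in RHS]mxE [X in _ = X + _ + _]mxE.
rewrite [X in _ = _ + X]mxE [(_ *: grad _ _) _ _]mxE [grad _ _ _ _]mxE partial_pressure//.
rewrite !mulNr; congr (_ + _ + _).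
rewrite [RHS]mxE [(_ *: divT _ _) _ _]mxE [divT _ _ _ _]mxE; congr (- (_ * _)).
apply: eq_bigr => j _; congr (partial _ _ _); apply/funext => y.
rewrite [RHS]mxE tensorE !mxE.
(* At zero density both sides vanish, since 0^-1 = 0. *)
have [->|D0] := eqVneq (density s eps y) 0; first by rewrite !mul0r invr0 mul0r.
by field.
Qed.

End State.
End LimitScheme.

(** * Facts common to periodic and no-flux domains *)

Section DomainFacts.
Context {R : realType} {d : nat}.
Local Notation V := 'rV[R]_d.
Implicit Types (D : domain R d) (s : multiscale R d).

Lemma region_open D : domain_ok D -> open (region D).
Proof. by case: D => [L _|A []] //=; exact: openT. Qed.

Lemma region_nonempty D : domain_ok D -> exists x, region D x.
Proof. by case: D => [L _|A [_ _ [x Ax] _]]; [exists 0|exists x]. Qed.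

Lemma region_const D k f : domain_ok D -> Ck k.+1 (region D) f ->
  (forall z i, region D z -> partial i f z = 0) ->
  forall x y, region D x -> region D y -> f x = f y.
Proof.
case: D => [L _|A [oA cA _ _]] Cf f0 x y Ax Ay;
  last exact: zero_gradient_const Cf f0 _ _ Ax Ay.
by rewrite -[x](subrK y) addrC; exact: (line_const Cf f0).
Qed.

Lemma region_div_const D (u : V -> V) c : (0 < d)%N -> domain_ok D ->
  (forall i, Ck 2 (region D) (fun x => u x 0 i)) -> velocity_bc D u ->
  (forall x, region D x -> div u x = c) -> c = 0.
Proof.
move=> d0; case: D => [L L0|A [oA _ A0 bA]] Cu bcu Hdiv.
  by apply: (periodic_div_const L0 bcu Cu) => x; exact: Hdiv.
exact: (noflux_div_const d0 oA A0 bA Cu bcu Hdiv).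
Qed.

(** The condition is linear and [u0] is a combination of the velocities at [eps = 1] and [eps = 2],
    so no limit is taken. *)
Lemma velocity_bc_u0 D s : (forall eps, 0 < eps -> velocity_bc D (velocity s eps)) ->
  velocity_bc D (u0 s).
Proof.
move=> H; have u0E x : u0 s x = 2 *: velocity s 1 x - velocity s 2 x.
  by apply/rowP => i; rewrite !mxE; ring.
case: D H => [L|A] /= H.
  by move=> x i; rewrite !u0E !(H _ _ x i).
by move=> y nu Ay Anu; rewrite u0E dotDl dotNl dotZl !H// mulr0 subr0.
Qed.

Lemma scalar_bc_rho2 D s : (forall eps, 0 < eps -> scalar_bc D (density s eps)) ->
  scalar_bc D (rho2 s).
Proof.
case: D => [L|//] /= H x i.
have rE y : rho2 s y = (density s 2 y - density s 1 y) / 3.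
  by rewrite /density; field.
by rewrite !rE !(H _ _ x i).
Qed.

End DomainFacts.

(** * Identification of the orders and the limit scheme *)

Section Limit.
Context {R : realType} {d : nat}.
Local Notation V := 'rV[R]_d.
Local Notation e_ i := (delta_mx 0 i : V).
Variables (D : domain R d) (gamma dt : R) (s s' : multiscale R d).
Hypotheses (hD : domain_ok D) (hdt : 0 < dt).
Hypotheses (hs : admissible D s) (hs' : admissible D s').
Hypothesis hwp : well_prepared D s.
Hypothesis hscheme : scheme D gamma dt s s'.
Let A := region D.
Let oA : open A := region_open hD.

Lemma grad_eq0 f x : grad f x = 0 :> V -> forall i, partial i f x = 0.
Proof. by move=> /rowP H i; have := H i; rewrite !mxE. Qed.

Lemma laplacianE (f : V -> R) x : laplacian f x = \sum_i partial i (partial i f) x.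
Proof.
apply: eq_bigr => i _; congr (partial i _ x).
by apply/funext => y; rewrite mxE.
Qed.

Let rho0_grad x i : A x -> partial i (rho0 s) x = 0.
Proof. by move=> Ax; apply: grad_eq0; exact: hwp.1. Qed.

Let qconv i := let: And5 C0 C2 Cu0 Cu1 (And3 pos _ _) := hs in
  qhat_converges oA gamma dt C0 C2 Cu0 Cu1 pos rho0_grad i.

Lemma momentum_orders x i : A x ->
  partial i (rho0 s') x = 0 /\
  rho0 s' x * u0 s' x 0 i =
    qhat0 s gamma dt i x - dt * partial i (rho2 s') x.
Proof.
move=> Ax; have [C0 C2 Cu0 Cu1 [pos _ _]] := hs'.
have [_ /(same_coefficients_coord i)] := hscheme Ax.
have lim1 : momentum s' eps x 0 i @[eps --> 0^'+] --> rho0 s' x * u0 s' x 0 i.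
  have := converges0 (convergesM oA (density_converges oA C0 C2)
    (velocity_converges oA Cu0 Cu1 i)) Ax.
  apply: cvg_trans; apply: near_eq_cvg; near=> eps.
  by rewrite /momentum [RHS]mxE.
have lim2 : qhat gamma dt eps (density s eps) (momentum s eps) x 0 i
    - dt * partial i (rho2 s') x @[eps --> 0^'+] -->
    qhat0 s gamma dt i x - dt * partial i (rho2 s') x.
  by apply: cvgB; [exact: converges0 (qconv i) _ Ax|exact: cvg_cst].
(* The momentum has no term of order [eps ^- 2]; on the right such a term comes only from the
   gradient of [rho0 s']. *)
move=> /(same_coefficients_eq (alpha := 0) _ lim1
  (alpha' := - (dt * partial i (rho0 s') x)) _ lim2).
case=> [eps e0|eps e0|/eqP H <-]; first by rewrite mulr0 add0r.
  rewrite [LHS]mxE [X in _ + X]mxE [X in - X]mxE [grad _ _ _ _]mxE.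
  rewrite (partial_density C0 C2)//.
  by field; rewrite gt_eqF.
move: H; rewrite eq_sym oppr_eq0 mulf_eq0 gt_eqF//= => /eqP H.
by split.
Unshelve. all: end_near. Qed.

(** On the left [rho2 s'] carries the factor [eps ^+ 2] and so reaches order 0; on the right [qhat]
    converges with its first derivatives, so its divergence passes to the limit. *)
Lemma elliptic_order0 x : A x ->
  - dt ^+ 2 * laplacian (rho2 s') x + rho0 s' x =
  rho0 s x - dt * \sum_i partial i (qhat0 s gamma dt i) x.
Proof.
move=> Ax; have [C0 C2 _ _ _] := hs'.
have [C0s C2s _ _ _] := hs.
have [H _] := hscheme Ax.
have lapE eps : laplacian (density s' eps) x =
    laplacian (rho0 s') x + eps ^+ 2 * laplacian (rho2 s') x.
  rewrite !laplacianE mulr_sumr -big_split/=; apply: eq_bigr => i _.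
  rewrite -[X in X + _]mul1r -partial_lin; first last.
  - exact: (Ck_derivable_partial (k := 0) oA C2 Ax).
  - exact: (Ck_derivable_partial (k := 0) oA C0 Ax).
  apply: (eq_partial_in oA) Ax => y Ay.
  by rewrite (partial_density C0 C2)// mul1r.
have lim1 : - dt ^+ 2 * laplacian (rho2 s') x + density s' eps x @[eps --> 0^'+] -->
    - dt ^+ 2 * laplacian (rho2 s') x + rho0 s' x.
  by apply: cvgD; [exact: cvg_cst|exact: converges0 (density_converges oA C0 C2) _ Ax].
have lim2 : density s eps x - dt * div (qhat gamma dt eps (density s eps) (momentum s eps)) x
    @[eps --> 0^'+] --> rho0 s x - dt * \sum_i partial i (qhat0 s gamma dt i) x.
  apply: cvgB; first exact: converges0 (density_converges oA C0s C2s) _ Ax.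
  apply: cvgM; first exact: cvg_cst.
  apply: cvg_finsum => i.
  exact: (converges0 (converges_partial i (qconv i)) Ax).
have := same_coefficients_eq (alpha := - (dt ^+ 2 * laplacian (rho0 s') x)) _ lim1
  (alpha' := 0) _ lim2 H.
case=> [eps e0|eps e0|//]; last by rewrite mulr0 add0r.
rewrite lapE; move: (laplacian (rho0 s') x) (laplacian (rho2 s') x) => l0 l2.
by move: (density s' eps x) => r; field; rewrite gt_eqF.
Qed.

Let x0 : V := projT1 (cid (region_nonempty hD)).
Let Ax0 : A x0 := projT2 (cid (region_nonempty hD)).

Lemma rho0_const x : A x -> rho0 s x = rho0 s x0.
Proof.
have [C0 _ _ _ _] := hs => Ax.
by apply: (region_const (k := 1) hD C0) => // z i Az; exact: rho0_grad.
Qed.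

Lemma rho0'_const x : A x -> rho0 s' x = rho0 s' x0.
Proof.
have [C0 _ _ _ _] := hs' => Ax.
by apply: (region_const (k := 1) hD C0) => // z i Az; exact: (momentum_orders i Az).1.
Qed.

Lemma div_u0' x : A x ->
  div (u0 s') x = (rho0 s x0 - rho0 s' x0) / (dt * rho0 s' x0).
Proof.
move=> Ax; have [C0 C2 Cu0 _ [pos _ _]] := hs'.
(* The order 0 momentum relation is differentiated with [rho0 s'] constant; in the sum over [i] the
   Laplacian of [rho2 s'] cancels that of the elliptic equation. *)
have Q i : partial i (qhat0 s gamma dt i) x =
    rho0 s' x0 * partial i (fun y => u0 s' y 0 i) x + dt * partial i (partial i (rho2 s')) x.
  rewrite -partial_lin; first last.
  - exact: (Ck_derivable_partial (k := 0) oA C2 Ax).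
  - exact: (Ck_derivable (k := 1) (Cu0 i) Ax).
  apply: (eq_partial_in oA) Ax => y Ay.
  by rewrite -(rho0'_const Ay) (momentum_orders i Ay).2 subrK.
have := elliptic_order0 Ax.
rewrite (eq_bigr _ (fun i _ => Q i)) big_split/= -!mulr_sumr -laplacianE -/(div (u0 s') x).
rewrite (rho0_const Ax) (rho0'_const Ax) => E.
have p0 : 0 < rho0 s' x0 by exact: pos.
apply: (mulIf (x := dt * rho0 s' x0)); first by rewrite mulf_neq0// gt_eqF.
rewrite divfK; last by rewrite mulf_neq0// gt_eqF.
by move: E; move: (laplacian _ _) (div _ _) => l v E; lra.
Qed.

Lemma limit_incompressible : (0 < d)%N ->
  well_prepared D s' /\ incompressible_scheme D dt (u0 s) (u0 s').
Proof.
move=> d0; have [C0' C2' Cu0' Cu1' [pos' sbc' vbc']] := hs'.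
have [C0 C2 Cu0 Cu1 [pos sbc vbc]] := hs.
have c0 := region_div_const d0 hD Cu0' (velocity_bc_u0 vbc') div_u0'.
have div0 x : A x -> div (u0 s') x = 0 by move=> /div_u0' ->.
have p0 : 0 < rho0 s' x0 by exact: pos'.
have rr : rho0 s x0 = rho0 s' x0.
  move/eqP: c0; rewrite mulf_eq0 invr_eq0 mulf_eq0 !(gt_eqF hdt, gt_eqF p0) !orbF.
  by rewrite subr_eq0 => /eqP.
split.
  split => // x Ax; apply/rowP => i; rewrite !mxE.
  exact: (momentum_orders i Ax).1.
split => //.
pose C := rho0 s x0; have C_gt0 : 0 < C by exact: pos.
(* Weights of the limit pressure after division by the constant density: [p'(C) - 1] at the old time
   from the explicit part, 1 at the new time from the implicit part. *)
pose a := (gamma * C `^ (gamma - 1) - 1) / C; pose b := C^-1.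
exists (fun x => a * rho2 s x + b * rho2 s' x); split.
- exact: Ck_lin.
- case: D sbc sbc' => [L|//] sbc1 sbc1' x i.
  by rewrite (scalar_bc_rho2 (D := Periodic L) sbc1)
             (scalar_bc_rho2 (D := Periodic L) sbc1').
move=> x Ax; apply/rowP => i.
have [_ M] := momentum_orders i Ax.
rewrite !mxE.
rewrite partial_lin; first last.
- exact: (Ck_derivable (k := 1) C2' Ax).
- exact: (Ck_derivable (k := 1) C2 Ax).
have T j : partial j (fun y => rho0 s y * (u0 s y 0 i * u0 s y 0 j)) x =
    C * partial j (fun y => tensor (u0 s y) (u0 s y) i j) x.
  have -> : (fun y => tensor (u0 s y) (u0 s y) i j) =
      (fun y => u0 s y 0 i * u0 s y 0 j).
    by apply/funext => y; rewrite tensorE.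
  have du : derivable (fun y => u0 s y 0 i * u0 s y 0 j) x (e_ j).
    exact: derivableM (Ck_derivable (k := 1) (Cu0 i) Ax)
                      (Ck_derivable (k := 1) (Cu0 j) Ax).
  rewrite -[RHS]addr0.
  (* A zero multiple is added to match the two-term form of [partial_lin]. *)
  rewrite -[X in _ + X](mul0r (partial j (fun y => u0 s y 0 i * u0 s y 0 j) x)).
  rewrite -partial_lin//.
  by apply: (eq_partial_in oA) Ax => y Ay; rewrite mul0r addr0 rho0_const.
move: M; rewrite /qhat0 (eq_bigr _ (fun j _ => T j)) -mulr_sumr.
rewrite (rho0_const Ax) (rho0'_const Ax) -rr -/C.
move: (\sum_j _) (partial i (rho2 s) x) (partial i (rho2 s') x) => S r2 r2' M.
have -> : u0 s' x 0 i = u0 s x 0 i - dt * S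
    - dt * ((gamma * C `^ (gamma - 1) - 1) * r2) / C - dt * r2' / C.
  apply: (mulfI (x := C)); first by rewrite gt_eqF.
  by rewrite M; field; rewrite gt_eqF.
by rewrite /a /b; field; rewrite !gt_eqF.
Qed.

End Limit.

Unset Implicit Arguments.
Set Strict Implicit.

Theorem proposition3p6 (R : realType) (d : nat) (hd : (1 <= d <= 3)%N)
    (D : domain R d) (hD : domain_ok D)
    (gamma : R) (hgamma : 1 <= gamma) (dt : R) (hdt : 0 < dt)
    (s s' : multiscale R d)
    (hs : admissible D s) (hs' : admissible D s')
    (hwp : well_prepared D s)
    (hscheme : scheme D gamma dt s s') :
  well_prepared D s' /\ incompressible_scheme D dt (u0 s) (u0 s').
Proof.
have [d0 _] := andP hd.
exact: (limit_incompressible hD hdt hs hs' hwp hscheme d0).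
Qed.
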